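(* Let $p\in(\tfrac{10}{3},6]$, $\gamma>0$ and $a<0$. There exist three constants $K_1,K_2,K_3>0$ such that for every $c>0$, if $\lambda_c\in\mathbb{R}$ denotes the Lagrange parameter associated to a solution $u_c$ lying at the level $m(c)=\inf_{u\in S(c)}F(u)$ (that is, $u_c\in S(c)$, $F(u_c)=m(c)$, and $u=u_c$ solves $-\Delta u+\lambda u-\gamma(|x|^{-1}*|u|^2)u-a|u|^{p-2}u=0$ in $\mathbb{R}^3$ with $\lambda=\lambda_c$), then $$|m(c)|\le K_1c^3+K_2c^{2p-3}\qquad\text{and}\qquad\lambda_c\le K_3c^2 .$$
   Context: $H^1(\mathbb{R}^3)$ is the usual Sobolev space of real-valued functions; solutions are weak solutions in $H^1(\mathbb{R}^3)$. For $u\in H^1(\mathbb{R}^3)$, $$F(u)=\frac12\int_{\mathbb{R}^3}|\nabla u|^2dx-\frac{\gamma}{4}\int_{\mathbb{R}^3}\int_{\mathbb{R}^3}\frac{|u(x)|^2|u(y)|^2}{|x-y|}\,dx\,dy-\frac{a}{p}\int_{\mathbb{R}^3}|u|^pdx ,$$ and $S(c)=\{u\in H^1(\mathbb{R}^3):\|u\|_{L^2}^2=c\}$. *)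

(* Defs.v *)
From mathcomp Require Import all_boot all_order all_algebra.
From mathcomp Require Import all_classical all_reals all_analysis.

Set Implicit Arguments.
Unset Strict Implicit.
Unset Printing Implicit Defensive.

Import Order.TTheory GRing.Theory Num.Theory numFieldNormedType.Exports.

Local Open Scope classical_set_scope.
Local Open Scope ring_scope.

Section Space.
Variable R : realType.

(* The three-dimensional space is [R * R * R]; its library norm is the sup
   norm, so the Euclidean norm is [enorm] below. *)
Notation R3 := (R * R * R)%type.

(* [measurableTypeR R] is [R] with the Borel sets carried by the library's
   Lebesgue measure. *)
Definition lebesgue3 :
    {measure set (measurableTypeR R * measurableTypeR R * measurableTypeR R)
     -> \bar R} :=
  ((@lebesgue_measure R \x @lebesgue_measure R) \x @lebesgue_measure R)%E.

Definition enorm (x : R3) : R :=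
  Num.sqrt (x.1.1 ^+ 2 + x.1.2 ^+ 2 + x.2 ^+ 2).

Definition basis3 (i : 'I_3) : R3 :=
  ((i == 0%N :> nat)%:R, (i == 1%N :> nat)%:R, (i == 2%N :> nat)%:R).

Fixpoint Ck (k : nat) (f : R3 -> R) : Prop :=
  if k is k'.+1 then
    continuous f /\
    forall i : 'I_3, (forall x, derivable f x (basis3 i)) /\
                     Ck k' (fun x => 'D_(basis3 i) f x)
  else continuous f.

Definition test_function (phi : R3 -> R) : Prop :=
  (forall k, Ck k phi) /\ compact (closure [set x | phi x != 0]).

Definition weak_partial_of (i : 'I_3) (u g : R3 -> R) : Prop :=
  forall phi, test_function phi ->
    (\int[lebesgue3]_x (u x * 'D_(basis3 i) phi x)%:E
     = - \int[lebesgue3]_x (g x * phi x)%:E)%E.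

(* Elements of L^2 and H^1 are represented by functions instead of classes
   modulo almost everywhere equality. *)
Definition H1 : set (R3 -> R) :=
  [set u | u \in Lfun lebesgue3 2%:E /\
    forall i, exists2 g, g \in Lfun lebesgue3 2%:E & weak_partial_of i u g].

(* The square-integrable weak derivative, unique up to a null set. *)
Definition weak_partial (i : 'I_3) (u : R3 -> R) : R3 -> R :=
  xget (fun=> 0) [set g | g \in Lfun lebesgue3 2%:E /\ weak_partial_of i u g].

Definition grad_dot (u v : R3 -> R) (x : R3) : R :=
  \sum_(i < 3) weak_partial i u x * weak_partial i v x.

Definition convolution (f g : R3 -> R) (x : R3) : \bar R :=
  (\int[lebesgue3]_y (f (x - y) * g y)%:E)%E.

Section Functional.
Variables p gamma a : R.

(* On H^1 and for 2 <= p <= 6 the three integrals are finite. *)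
Definition F (u : R3 -> R) : \bar R :=
  ((2^-1)%:E * \int[lebesgue3]_x (grad_dot u u x)%:E
   - (gamma / 4)%:E * \int[lebesgue3]_x \int[lebesgue3]_y
       (`|u x| ^+ 2 * `|u y| ^+ 2 / enorm (x - y))%:E
   - (a / p)%:E * \int[lebesgue3]_x (`|u x| `^ p)%:E)%E.

Definition sphere (c : R) : set (R3 -> R) :=
  [set u | H1 u /\ ('N[lebesgue3]_2%:E [EFin \o u] ^+ 2 = c%:E)%E].

Definition m (c : R) : \bar R := ereal_inf [set F u | u in sphere c].

(* - Delta u + lambda u - gamma (|x|^-1 * |u|^2) u - a |u|^(p-2) u = 0,
   tested against H^1. *)
Definition weak_solution (lambda : R) (u : R3 -> R) : Prop :=
  H1 u /\
  forall v, H1 v ->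
    (\int[lebesgue3]_x (grad_dot u v x)%:E
     + lambda%:E * \int[lebesgue3]_x (u x * v x)%:E
     - gamma%:E * \int[lebesgue3]_x
         (convolution (fun z => (enorm z)^-1)%R (fun z => `|u z| ^+ 2)%R x
          * (u x * v x)%:E)
     - a%:E * \int[lebesgue3]_x (`|u x| `^ (p - 2) * u x * v x)%:E
     = 0)%E.

End Functional.
End Space.

(* Main.v *)
Require Import Defs.
From HB Require Import structures.
From mathcomp Require Import all_boot all_order all_algebra.
From mathcomp Require Import all_classical all_reals all_analysis.
From mathcomp Require Import measurable_realfun.
From mathcomp Require Import ring lra.

Set Implicit Arguments.
Unset Strict Implicit.
Unset Printing Implicit Defensive.

Import Order.TTheory GRing.Theory Num.Theory numFieldNormedType.Exports.
Local Open Scope classical_set_scope.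
Local Open Scope ring_scope.

(** Write [A], [D], [B] for the integrals of [|grad u|^2], of the Coulomb double
    integrand and of [|u|^p].  Everything follows from the Coulomb bound
    [D <= e A + 32 c^3 / e] for every [e > 0].  To obtain it, fix [x] and bound
    [1 / |x - y|] by the sum of its restrictions to
    [|x_3 - y_3| <= |x_2 - y_2|] and to the opposite region; on the first one,
    the integral of [1 / |x - y|] over [y_3] is at most 2, while the
    one-dimensional inequality [sup f^2 <= 4 int |f f'|] controls [u^2] on almost
    every line parallel to the third axis (symmetrically for the second region).
    Hence the potential at [x] is at most
    [8 int |u d_2 u| + 8 int |u d_3 u|], and Young's inequality concludes.

    Testing the equation against [u] gives [A + lambda c = gamma D + a B] and the
    finiteness of [B]; with [a < 0] and [e = 1 / gamma] it bounds [lambda].  With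
    [e = 2 / gamma], [F u >= - 4 gamma^2 c^3].  Finally
    [t^3 u (t^2 x)] lies on the same sphere and its energy is [O(t)], so
    [m c <= 0]. *)

(** * Smooth bumps and test functions *)

(** What shapes the Coulomb estimate is that [1 / |x - y|] is not integrable along a line, since it
    decays only like [1 / |s|]. The truncation confines the line variable to an interval of
    half-length [r], where [r] is the difference in the other coordinate and is constant on the
    line, and the kernel is at most [1 / r] there. The resulting bound does not depend on the line
    and can be paired with a supremum bound for [u^2].

    Weak derivatives are defined by test functions on the whole space, so passing to lines discards
    a null set for each test. A countable family keeps the union null: tensor products of smooth
    bumps with rational endpoints, together with the compactly supported primitives that the du
    Bois-Reymond argument requires.

    The comparison functions for [m c <= 0] are dilations of the solution itself, whose power
    integral is finite by the equation. Writing the dilation factor as [t^2] makes the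
    mass-preserving amplitude [t^3] an integer power; as [p > 3], the gradient and power terms are
    both [O(t)], while the Coulomb term has the favourable sign. *)

Section SmoothLine.
Context {R : realType}.
Implicit Types (f g : R -> R) (p : {poly R}).

Definition flat p (x : R) : R :=
  if 0 < x then p.[x^-1] * expR (- x^-1) else 0.

(** With [v = 1 / x], one term of the exponential series gives [v^(i+2) <= (i+2)! e^v], hence
    [v^i e^(-v) <= (i+2)! x^2] for each monomial. A quadratic bound is what makes the difference
    quotient at 0 vanish in the limit. *)
Lemma flat_bound p : exists C, 0 <= C /\ forall x, `|flat p x| <= C * x ^+ 2.
Proof.
exists (\sum_(i < size p) `|p`_i| * (i.+2)`!%:R).
split; first by apply: sumr_ge0 => i _; rewrite mulr_ge0.
move=> x; rewrite /flat; case: ifPn => x0; last first.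
  rewrite normr0 mulr_ge0 ?sqr_ge0//.
  by apply: sumr_ge0 => i _; rewrite mulr_ge0.
rewrite normrM (ger0_norm (expR_ge0 _)) horner_coef.
apply: (@le_trans _ _
    ((\sum_(i < size p) `|p`_i * x^-1 ^+ i|) * expR (- x^-1))).
  by rewrite ler_wpM2r ?expR_ge0// ler_norm_sum.
rewrite !mulr_suml; apply: ler_sum => i _.
rewrite normrM -!mulrA; apply: ler_wpM2l => //.
have v0 : 0 <= x^-1 by rewrite invr_ge0 ltW.
rewrite ger0_norm ?exprn_ge0//.
rewrite expRN.
have := expR_ge1Dxn i.+1 (ltW (etrans (invr_gt0 x) x0)).
have e0 : 0 < (i.+2)`!%:R :> R by rewrite ltr0n fact_gt0.
move=> h; have {}h : x^-1 ^+ i.+2 <= (i.+2)`!%:R * expR x^-1.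
  by rewrite -ler_pdivrMl// mulrC; apply: le_trans h; rewrite lerDr.
rewrite ler_pdivrMr ?expR_gt0// -mulrA mulrCA.
have -> : x^-1 ^+ i = x ^+ 2 * x^-1 ^+ i.+2.
  by rewrite -(add2n i) exprD mulrA -exprMn divff ?gt_eqF// expr1n mul1r.
by rewrite ler_wpM2l ?sqr_ge0.
Qed.

(** Since [v = 1 / x] has derivative [- v^2], differentiating [P(v) e^(-v)] yields
    [v^2 (P - P')(v) e^(-v)]. The family is thus closed under differentiation, and smoothness
    follows by induction with the polynomial generalized. *)
Lemma is_derive_flat p (x : R) :
  is_derive x 1 (flat p) (flat ('X^2 * (p - p^`())) x).
Proof.
have [x0|x0|->] := ltgtP x 0.
- rewrite {2}/flat ltNge (ltW x0) /=.
  apply: (@near_eq_is_derive _ _ _ (cst 0)).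
  by near=> y; rewrite /flat ltNge ltW//; near: y; exact: lt_nbhsl.
- have xn0 : x != 0 by rewrite gt_eqF.
  have -> : flat ('X^2 * (p - p^`())) x =
     (p^`()).[x^-1] * (- x ^- 2) * expR (- x^-1) +
     p.[x^-1] * (expR (- x^-1) * (x^-2)).
    by rewrite /flat x0 hornerM hornerXn hornerD hornerN; field.
  apply: (@near_eq_is_derive _ _ _ (fun y : R => p.[y^-1] * expR (- y^-1))).
    by near=> y; rewrite /flat ifT//; near: y; exact: lt_nbhsr.
  have dV : is_derive x 1 (fun y : R => y^-1) (- x ^- 2).
    apply: (is_derive_eq (@is_deriveV _ id x 1 1 xn0 (is_derive_id x 1))).
    by rewrite /GRing.scale/= mulr1.
  have dE : is_derive x 1 (fun y : R => expR (- y^-1)) (x ^- 2 * expR (- x^-1)).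
    apply: is_derive_eq.
    by rewrite opprK mulrC.
  have dP : is_derive x 1 (fun y : R => p.[y^-1]) (p^`().[x^-1] * - x ^- 2).
    by apply: is_derive_eq; rewrite /GRing.scale/= mulrC.
  apply: is_derive_eq; rewrite /GRing.scale/=; ring.
- have [C [C0 hC]] := flat_bound p.
  rewrite {2}/flat ltxx.
  have C1 : 0 < C + 1 by rewrite ltr_wpDl.
  have f0 : flat p 0 = 0 by rewrite /flat ltxx.
  suff h : h^-1 *: (flat p (h *: 1 + 0) - flat p 0) @[h --> 0^'] --> (0 : R).
    by split; [apply/cvg_ex; exists 0|exact/cvg_lim].
  apply/cvgrPdist_le => e e0; near=> h.
  have hn0 : h != 0 by near: h; exact: nbhs_dnbhs_neq.
  rewrite sub0r normrN f0 subr0 addr0 /GRing.scale/= mulr1 normrM normfV.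
  rewrite ler_pdivrMl ?normr_gt0//; apply: le_trans (hC h) _.
  rewrite -real_normK ?num_real// expr2 mulrA [leRHS]mulrC ler_wpM2r//.
  have hle : `|h| <= e / (C + 1).
    by near: h; exact/dnbhs0_le/divr_gt0.
  apply: (@le_trans _ _ ((C + 1) * `|h|)).
    by apply: ler_wpM2r; rewrite ?lerDl ?ler01.
  by rewrite mulrC -ler_pdivlMr.
Unshelve. all: end_near. Qed.

Fixpoint Dk k f : Prop :=
  if k is k'.+1 then (forall x, derivable f x 1) /\ Dk k' (derive1 f) else continuous f.

Definition smooth f := forall k, Dk k f.

Lemma derive1_funE f f' : (forall x : R, is_derive x 1 f (f' x)) -> derive1 f = f'.
Proof. by move=> h; apply/funext => x; rewrite derive1E; exact: derive_val. Qed.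

Lemma derivable1_continuous f : (forall x, derivable f x 1) -> continuous f.
Proof. by move=> df x; exact/differentiable_continuous/derivable1_diffP. Qed.

Lemma DkS k f : Dk k.+1 f -> Dk k f.
Proof.
elim: k f => [|k IH] f [df dk]; first exact: derivable1_continuous.
by split => //; exact: IH.
Qed.

Lemma smooth_derive1 f : smooth f -> smooth (derive1 f).
Proof. by move=> sf k; have [] := sf k.+1. Qed.

Lemma smooth_is_derive f : smooth f -> forall x : R, is_derive x 1 f (derive1 f x).
Proof. by move=> /(_ 1%N)[df _] x; rewrite derive1E; exact: derivableP. Qed.

Lemma smooth_primitive f f' :
  (forall x : R, is_derive x 1 f (f' x)) -> smooth f' -> smooth f.
Proof.
move=> df sf' [|k]; first by apply: derivable1_continuous => x; case: (df x).
by split=> [x|]; [case: (df x)|rewrite (derive1_funE df)].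
Qed.

Lemma smooth_continuous f : smooth f -> continuous f.
Proof. by move/(_ 0%N). Qed.

Lemma Dk_cst k c : Dk k (cst c).
Proof.
elim: k c => [|k IH] c; first by move=> x; exact: cvg_cst.
have E (x : R) : is_derive x 1 (cst c : R -> R) (cst 0 x) by exact: is_derive_cst.
by split=> [x|]; [exact: derivable_cst|rewrite (derive1_funE E)].
Qed.

Lemma Dk_add k f g : Dk k f -> Dk k g -> Dk k (f \+ g).
Proof.
elim: k f g => [|k IH] f g /=; first by move=> cf cg x; exact: (cvgD (cf x) (cg x)).
move=> [df kf] [dg kg]; split=> [x|]; first exact: derivableD.
have E (x : R) : is_derive x 1 (f \+ g) ((derive1 f \+ derive1 g) x).
  by rewrite /= !derive1E; apply: is_deriveD; apply: derivableP.
by rewrite (derive1_funE E); exact: IH.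
Qed.

Lemma Dk_mul k f g : Dk k f -> Dk k g -> Dk k (f \* g).
Proof.
elim: k f g => [|k IH] f g; first by move=> cf cg x; exact: (cvgM (cf x) (cg x)).
move=> Df Dg; have [df kf] := Df; have [dg kg] := Dg.
split=> [x|]; first exact: derivableM.
have E (x : R) : is_derive x 1 (f \* g) (((f \* derive1 g) \+ (g \* derive1 f)) x).
  by rewrite /= !derive1E; apply: is_deriveM; apply: derivableP.
by rewrite (derive1_funE E); apply: Dk_add; apply: IH => //; exact: DkS.
Qed.

Lemma Dk_affine k f a b : Dk k f -> Dk k (fun x => f (a * x + b)).
Proof.
elim: k f => [|k IH] f.
  move=> cf x; apply: (@continuous_comp _ _ _ (fun x => a * x + b) f); last exact: cf.
  by apply: cvgD; [exact: mulrl_continuous|exact: cvg_cst].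
move=> [df kf].
have d (x : R) : is_derive x 1 (fun x => f (a * x + b)) (a * derive1 f (a * x + b)).
  have da : is_derive x 1 (fun x => a * x + b) a.
    by apply: is_derive_eq; rewrite addr0 /GRing.scale/= mulr1.
  have dfx : is_derive (a * x + b) 1 f (derive1 f (a * x + b)).
    by rewrite derive1E; exact: derivableP.
  by rewrite mulrC; exact: (@is_derive1_comp _ f (fun x => a * x + b) x _ _ dfx da).
split=> [x|]; first by case: (d x).
by rewrite (derive1_funE d); apply: Dk_mul; [exact: Dk_cst|exact: IH].
Qed.

Lemma smooth_flat p : smooth (flat p).
Proof.
move=> k; elim: k p => [|k IH] p.
  by apply: derivable1_continuous => x; case: (is_derive_flat p x).
by split=> [x|]; [case: (is_derive_flat p x)|
  rewrite (derive1_funE (is_derive_flat p))].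
Qed.

Definition expVN := flat 1.

Lemma expVNE x : 0 < x -> expVN x = expR (- x^-1).
Proof. by move=> x0; rewrite /expVN /flat x0 hornerE mul1r. Qed.

Lemma expVN_le0 x : x <= 0 -> expVN x = 0.
Proof. by rewrite /expVN /flat ltNge => ->. Qed.

Lemma expVN_ge0 x : 0 <= expVN x.
Proof.
by have [/expVN_le0->//|/expVNE->] := leP x 0; exact: expR_ge0.
Qed.

Lemma expVN_gt0 x : 0 < x -> 0 < expVN x.
Proof. by move/expVNE->; exact: expR_gt0. Qed.

Lemma expVN_le1 x : expVN x <= 1.
Proof.
have [/expVN_le0->//|x0] := leP x 0.
by rewrite expVNE// expR_le1 oppr_le0 invr_ge0 ltW.
Qed.

Lemma expVN_homo : {homo expVN : x y / x <= y}.
Proof.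
move=> x y xy; have [/expVN_le0->|x0] := leP x 0; first exact: expVN_ge0.
have y0 := lt_le_trans x0 xy.
by rewrite !expVNE// ler_expR lerN2 lef_pV2.
Qed.

(** The index [n] is a steepness: as it grows, the bump tends pointwise to the indicator of []a,
    b[], so countably many bumps suffice to recover integrals over intervals. *)
Definition bump (a b : R) (n : nat) (x : R) :=
  expVN (n.+1%:R * (x - a)) * expVN (n.+1%:R * (b - x)).

Lemma smooth_bump a b n : smooth (bump a b n).
Proof.
move=> k; rewrite (_ : bump a b n =
    (fun x => expVN (n.+1%:R * x + - (n.+1%:R * a))) \*
    (fun x => expVN (- n.+1%:R * x + n.+1%:R * b))); last first.
  by apply/funext => x; rewrite /bump /=; congr (expVN _ * expVN _); ring.
by apply: Dk_mul; apply: Dk_affine; exact: smooth_flat.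
Qed.

Lemma bump_ge0 a b n x : 0 <= bump a b n x.
Proof. by rewrite mulr_ge0// expVN_ge0. Qed.

Lemma bump_le1 a b n x : bump a b n x <= 1.
Proof. by rewrite mulr_ile1// ?expVN_ge0// expVN_le1. Qed.

Lemma bump_out a b n x : ~~ (a < x < b) -> bump a b n x = 0.
Proof.
rewrite /bump negb_and -!leNgt => /orP[h|h].
  by rewrite expVN_le0 ?mul0r// mulr_ge0_le0// subr_le0.
by rewrite mulrC expVN_le0 ?mul0r// mulr_ge0_le0// subr_le0.
Qed.

Lemma bump_gt0 a b n x : a < x < b -> 0 < bump a b n x.
Proof. by case/andP=> ax xb; rewrite mulr_gt0// expVN_gt0// mulr_gt0// subr_gt0. Qed.

Definition compact_supp f := exists L : R, forall x, L <= `|x| -> f x = 0.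

Lemma compact_supp_bump a b n : compact_supp (bump a b n).
Proof.
exists (`|a| + `|b|) => x h; apply: bump_out; apply/negP => /andP[ax xb].
move: h; rewrite leNgt => /negP; apply.
have := ler_norm b; have := ler_norm (- a); rewrite normrN => h1 h2.
have := normr_ge0 a; have := normr_ge0 b => h3 h4.
by rewrite ltr_norml; apply/andP; split; lra.
Qed.

End SmoothLine.

(** * Tensor products of one-variable test functions *)

Section Tensor.
Context {R : realType}.
Notation R3 := (R * R * R)%type.

(** The two difference quotients are the same function, so partial derivatives can be computed with
    the one-variable rules. *)
Lemma is_derive_line {V : normedModType R} (F : V -> R) (k : R -> R) x v s (d : R) :
  (forall h : R, F (h *: v + x) = k (h + s)) -> is_derive s 1 k d ->
  is_derive x v F d.
Proof.
move=> Fk [dk <-].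
have E : (fun h : R => h^-1 *: (F (h *: v + x) - F x)) =
         (fun h : R => h^-1 *: (k (h *: 1 + s) - k s)).
  apply/funext => h; rewrite Fk /GRing.scale/= mulr1.
  by have := Fk 0; rewrite scale0r !add0r => ->.
by split; [rewrite /derivable E|rewrite /derive E].
Qed.

Definition tens (f g h : R -> R) (x : R3) : R := f x.1.1 * g x.1.2 * h x.2.

Lemma continuous_tens f g h :
  continuous f -> continuous g -> continuous h -> continuous (tens f g h).
Proof.
move=> cf cg ch x.
have c1 : {for x, continuous (fun x : R3 => f x.1.1)}.
  apply: (@continuous_comp _ _ _ (fun x : R3 => x.1.1) f); last exact: cf.
  by apply: continuous_comp; [exact: cvg_fst|exact: cvg_fst].
have c2 : {for x, continuous (fun x : R3 => g x.1.2)}.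
  apply: (@continuous_comp _ _ _ (fun x : R3 => x.1.2) g); last exact: cg.
  by apply: continuous_comp; [exact: cvg_fst|exact: cvg_snd].
have c3 : {for x, continuous (fun x : R3 => h x.2)}.
  apply: (@continuous_comp _ _ _ (fun x : R3 => x.2) h); last exact: ch.
  exact: cvg_snd.
exact: (cvgM (cvgM c1 c2) c3).
Qed.

Definition derive_if (b : bool) (f : R -> R) : R -> R := if b then derive1 f else f.

Lemma smooth_derive_if b f : smooth f -> smooth (derive_if b f).
Proof. by case: b => //; exact: smooth_derive1. Qed.

Lemma is_derive_tens (i : 'I_3) f g h x : smooth f -> smooth g -> smooth h ->
  is_derive x (basis3 R i) (tens f g h)
   (tens (derive_if (i == 0%N :> nat) f) (derive_if (i == 1%N :> nat) g)
      (derive_if (i == 2%N :> nat) h) x).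
Proof.
move=> /smooth_is_derive sf /smooth_is_derive sg /smooth_is_derive sh.
case: x => [[x1 x2] x3]; have {}sf := sf x1; have {}sg := sg x2; have {}sh := sh x3.
case: i => m; move: m => [|[|[|m]]] lt_m3 //.
- have D : is_derive x1 1 (fun t => f t * g x2 * h x3) (derive1 f x1 * g x2 * h x3).
    by apply: is_derive_eq; rewrite /GRing.scale/=; ring.
  apply: is_derive_line D.
  by move=> t; rewrite /tens/= /GRing.scale/= mulr1 !mulr0 !add0r.
- have D : is_derive x2 1 (fun t => f x1 * g t * h x3) (f x1 * derive1 g x2 * h x3).
    by apply: is_derive_eq; rewrite /GRing.scale/=; ring.
  apply: is_derive_line D.
  by move=> t; rewrite /tens/= /GRing.scale/= mulr1 !mulr0 !add0r.
- have D : is_derive x3 1 (fun t => f x1 * g x2 * h t) (f x1 * g x2 * derive1 h x3).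
    by apply: is_derive_eq; rewrite /GRing.scale/=; ring.
  apply: is_derive_line D.
  by move=> t; rewrite /tens/= /GRing.scale/= mulr1 !mulr0 !add0r.
Qed.

Lemma derive_tens (i : 'I_3) f g h : smooth f -> smooth g -> smooth h ->
  (fun x => 'D_(basis3 R i) (tens f g h) x) =
   tens (derive_if (i == 0%N :> nat) f) (derive_if (i == 1%N :> nat) g)
      (derive_if (i == 2%N :> nat) h).
Proof.
by move=> sf sg sh; apply/funext => x; have [] := is_derive_tens i x sf sg sh.
Qed.

Lemma Ck_tens k f g h : smooth f -> smooth g -> smooth h -> Ck k (tens f g h).
Proof.
elim: k f g h => [|k IH] f g h sf sg sh.
  by apply: continuous_tens; exact: smooth_continuous.
split; first by apply: continuous_tens; exact: smooth_continuous.
move=> i; split=> [x|]; first by case: (is_derive_tens i x sf sg sh).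
by rewrite derive_tens//; apply: IH; exact: smooth_derive_if.
Qed.

Definition test1 (f : R -> R) := smooth f /\ compact_supp f.

Lemma test_function_tens f g h :
  test1 f -> test1 g -> test1 h -> test_function (tens f g h).
Proof.
move=> [sf [Lf hf]] [sg [Lg hg]] [sh [Lh hh]].
split=> [k|]; first exact: Ck_tens.
pose K := (`[- Lf, Lf] `*` `[- Lg, Lg]) `*` `[- Lh, Lh] : set R3.
have cK : compact K by do 2 (apply: compact_setX; last exact: segment_compact);
  exact: segment_compact.
apply: (@subclosed_compact _ _ K) => //; first exact: closed_closure.
have clK : closed K by apply: compact_closed => //; exact: norm_hausdorff.
rewrite (proj1 (closure_id K) clK).
apply: closureS => -[[x1 x2] x3] /=; rewrite /tens/= => n0.
split; [split|] => /=; rewrite in_itv /= -ler_norml leNgt; apply/negP => /ltW h0;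
  move: n0; rewrite ?(hf _ h0) ?(hg _ h0) ?(hh _ h0) ?mul0r ?mulr0 ?mul0r ?eqxx//.
Qed.

Lemma test1_integrable f : test1 f ->
  (@lebesgue_measure R).-integrable setT (EFin \o f).
Proof.
move=> [sf [L hL]].
have fL : f = f \_ `[- L, L].
  apply/funext => x; rewrite patchE; case: ifPn => // /negP xL.
  apply: hL; rewrite leNgt; apply/negP => /ltW; rewrite ler_norml => h.
  by apply: xL; rewrite inE /= in_itv.
rewrite (_ : EFin \o f = (EFin \o f) \_ `[- L, L]); last first.
  by rewrite restrict_EFin -fL.
apply: (proj1 (integrable_mkcond (mu := @lebesgue_measure R) _ _)) => //.
apply: continuous_compact_integrable; first exact: segment_compact.
exact/continuous_subspaceT/smooth_continuous.
Qed.

(* Integrating from -oo yields a compactly supported primitive because the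
   derivative has zero mean. *)
Lemma test1_primitive f : test1 f -> \int[@lebesgue_measure R]_x f x = 0 ->
  exists2 psi, test1 psi & derive1 psi = f.
Proof.
move=> tf f0; have iF := test1_integrable tf; have [sf [L hL]] := tf.
pose psi x := \int[@lebesgue_measure R]_(t in `]-oo, x]) f t.
have FTC x : derivable psi x 1 /\ derive1 psi x = f x.
  apply: (@continuous_FTC1 _ f -oo%O x (x + 1)) => //.
  - by rewrite ltrDl.
  - by apply: integrableS iF => //.
  - by rewrite ltNyr.
  - exact: smooth_continuous.
exists psi; last by apply/funext => x; case: (FTC x).
split.
  apply: (@smooth_primitive _ _ f) => // x.
  by have [d <-] := FTC x; rewrite derive1E; exact: derivableP.
exists L => x Lx; rewrite /psi Rintegral_mkcond.
have [x0|x0] := leP x 0.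
  rewrite (_ : f \_ _ = cst 0) ?Rintegral_cst ?mul0r//.
  apply/funext => t; rewrite patchE; case: ifPn => //.
  rewrite inE /= in_itv /= => tx; apply: hL; apply: le_trans Lx _.
  by rewrite !ler0_norm ?lerN2// (le_trans tx).
rewrite (_ : f \_ _ = f) //.
apply/funext => t; rewrite patchE; case: ifPn => //.
rewrite notin_setE /= in_itv /= => /negP; rewrite -ltNge => tx; apply/esym/hL.
by apply: le_trans Lx _; rewrite !gtr0_norm ?ltW// (lt_trans x0).
Qed.

End Tensor.

(** * Families of test functions detecting null functions *)

Section Total.
Context {R : realType}.
Local Open Scope ereal_scope.

(* [filterS] for the almost-everywhere filter; stated separately because
   its filter instance is not inferred over [measurableTypeR]. *)
Lemma aeS d (T : measurableType d) (mu : {measure set T -> \bar R}) (P Q : T -> Prop) :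
  (forall x, P x -> Q x) -> {ae mu, forall x, P x} -> {ae mu, forall x, Q x}.
Proof. exact: filterS. Qed.

Lemma aeS2 d (T : measurableType d) (mu : {measure set T -> \bar R})
    (P Q S : T -> Prop) : (forall x, P x -> Q x -> S x) ->
  {ae mu, forall x, P x} -> {ae mu, forall x, Q x} -> {ae mu, forall x, S x}.
Proof. exact: filterS2. Qed.

Lemma ae_forall_countable d (T : measurableType d) (mu : {measure set T -> \bar R})
    (I : countType) (P : I -> T -> Prop) :
  (forall i, {ae mu, forall x, P i x}) -> {ae mu, forall x, forall i, P i x}.
Proof.
move=> aeP.
pose Q n x := if unpickle n is Some i then P i x else True.
have : {ae mu, forall x, forall n, Q n x}.
  apply/ae_foralln => n; rewrite /Q; case: unpickle => [i|]; first exact: aeP.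
  exact: aeW.
by apply: filterS => x h i; have := h (pickle i); rewrite /Q pickleK.
Qed.

Lemma ae_eq_integrable d (T : measurableType d) (mu : {measure set T -> \bar R})
    (f g : T -> \bar R) :
  measurable_fun setT g -> ae_eq mu setT f g ->
  mu.-integrable setT f -> mu.-integrable setT g.
Proof.
move=> mg fg /integrableP[mf foo]; apply/integrableP; split=> //.
rewrite (@ge0_ae_eq_integral _ _ _ mu setT (abse \o g) (abse \o f)) //;
  do ?[exact: measurableT_comp|by move=> x _; exact: abse_ge0].
by apply: ae_eq_abse; exact: ae_eq_sym.
Qed.

(** The integral is by definition the difference of those of the positive and negative parts, and
    Tonelli handles each; slices that are not integrable are therefore allowed. *)
Lemma measurable_fubini_integral d1 d2 (T1 : measurableType d1)
    (T2 : measurableType d2) (m2 : {sigma_finite_measure set T2 -> \bar R})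
    (f : T1 * T2 -> \bar R) : measurable_fun setT f ->
  measurable_fun setT (fun x => \int[m2]_y f (x, y)).
Proof.
move=> mf.
rewrite (_ : (fun x => _) = (fun x => \int[m2]_y f^\+ (x, y)) \-
    (fun x => \int[m2]_y f^\- (x, y))).
  by apply: emeasurable_funB; apply: measurable_fun_fubini_tonelli_F => //;
    [exact: measurable_funepos|exact: measurable_funeneg].
apply/funext => x; rewrite [LHS]integralE/=; congr (_ - _); apply: eq_integral => y _.
- exact: (congr1 (@^~ y) (funepos_comp f (pair x))).
- exact: (congr1 (@^~ y) (funeneg_comp f (pair x))).
Qed.

Lemma integral_prod_eq0 d1 d2 (T1 : measurableType d1) (T2 : measurableType d2)
    (m1 : {sigma_finite_measure set T1 -> \bar R})
    (m2 : {sigma_finite_measure set T2 -> \bar R}) (h : T1 * T2 -> R) :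
  measurable_fun setT h ->
  {ae m1, forall x, {ae m2, forall y, h (x, y) = 0%R}} ->
  {ae m1 \x m2, forall z, h z = 0%R}.
Proof.
move=> mh h0.
have mEh : measurable_fun setT (fun z => `|(h z)%:E|).
  by apply: measurableT_comp => //; exact/measurable_EFinP.
have : ae_eq (m1 \x m2) setT (EFin \o h) (cst 0).
  apply/ae_eq_integral_abs => //; first exact/measurable_EFinP.
  rewrite (fubini_tonelli1 (fun z => `|(h z)%:E|))//.
  rewrite (ae_eq_integral (cst 0)) ?integral0//.
    exact: (measurable_fun_fubini_tonelli_F (fun z => `|(h z)%:E|)).
  apply: filterS h0 => x /= h0 _; rewrite /fubini_F.
  rewrite (ae_eq_integral (cst 0)) ?integral0//.
    exact: (measurable_fun_pair2 x mEh).
  by apply: filterS h0 => y /= -> _; rewrite normr0.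
by apply: filterS => z /(_ I)[].
Qed.

(* Testing against the family detects null functions; integrability of the
   products is part of the test, so no integrability of [h] is required. *)
Definition total_family d (T : measurableType d) (mu : {measure set T -> \bar R})
    (I : countType) (b : I -> T -> R) :=
  [/\ forall i, measurable_fun setT (b i), forall x, exists i, b i x != 0%R &
   forall h : T -> R, measurable_fun setT h ->
     (forall i, mu.-integrable setT (fun x => (h x * b i x)%:E)) ->
     (forall i, \int[mu]_x (h x * b i x)%:E = 0) ->
     {ae mu, forall x, h x = 0%R}].

(** Pairing [h] with [b2 j] in the second variable gives a function [H j] of the first that is
    orthogonal to every [b1 i], hence null. As the indices [j] are countable, almost every slice is
    orthogonal to all [b2 j] at once, and totality of the second family applies to it. *)
Lemma total_family_prod d1 d2 (T1 : measurableType d1) (T2 : measurableType d2)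
    (m1 : {sigma_finite_measure set T1 -> \bar R})
    (m2 : {sigma_finite_measure set T2 -> \bar R}) (I1 I2 : countType)
    (b1 : I1 -> T1 -> R) (b2 : I2 -> T2 -> R) :
  total_family m1 b1 -> total_family m2 b2 ->
  total_family (m1 \x m2) (fun (i : I1 * I2) z => b1 i.1 z.1 * b2 i.2 z.2)%R.
Proof.
move=> [mb1 nb1 tb1] [mb2 nb2 tb2]; split.
- move=> [i j]; apply: measurable_funM.
    exact: measurableT_comp (mb1 i) measurable_fst.
  exact: measurableT_comp (mb2 j) measurable_snd.
- move=> [x y]; have [i b1x] := nb1 x; have [j b2y] := nb2 y.
  by exists (i, j); rewrite mulf_neq0.
move=> h mh ih h0; apply: integral_prod_eq0 => //.
pose H j x := fine (\int[m2]_y (h (x, y) * b2 j y)%:E).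
have mhb j : measurable_fun setT (fun z : T1 * T2 => (h z * b2 j z.2)%:E).
  apply/measurable_EFinP/measurable_funM => //.
  exact: measurableT_comp (mb2 j) measurable_snd.
have mH j : measurable_fun setT (H j).
  by apply: measurableT_comp => //; exact: measurable_fubini_integral (mhb j).
have aei : {ae m1, forall x, forall j,
    m2.-integrable setT (fun y => (h (x, y) * b2 j y)%:E)}.
  have : {ae m1, forall x, forall ij : I1 * I2,
      m2.-integrable setT (fun y => (h (x, y) * (b1 ij.1 x * b2 ij.2 y))%:E)}.
    by apply: ae_forall_countable => ij; exact: ae_integrable1 (ih ij).
  (* Fubini gives integrability of the slice only up to the factor [b1 i x]; choosing [i] so that
     this factor is nonzero at [x] allows dividing by it. This is the purpose of the second clause
     of [total_family]. *)
  apply: filterS => x hx j; have [i b1x] := nb1 x.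
  have /(integrableZl measurableT (b1 i x)^-1%R) := hx (i, j).
  apply: eq_integrable => // y _ /=; rewrite -EFinM; congr EFin.
  by field.
have H0 : {ae m1, forall x, forall j, H j x = 0%R}.
  apply: ae_forall_countable => j.
  have FE i : ae_eq m1 setT
      (fun x => \int[m2]_y (h (x, y) * (b1 i x * b2 j y))%:E)
      (fun x => (H j x * b1 i x)%:E).
    apply: filterS aei => x /(_ j) ix _.
    rewrite EFinM fineK; last exact: integrable_fin_num.
    rewrite -integralZr//; apply: eq_integral => y _.
    by rewrite -EFinM; congr EFin; ring.
  have mHb i : measurable_fun setT (fun x => (H j x * b1 i x)%:E).
    by apply/measurable_EFinP; exact: measurable_funM.
  apply: tb1 => // i.
    apply: (ae_eq_integrable (mHb i) (FE i)).
    exact: integrable_fubini_F (ih (i, j)).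
  rewrite -(h0 (i, j)) -(integral12_prod_meas1 (ih (i, j))).
  apply: ae_eq_integral => //; last exact/ae_eq_sym/FE.
  exact: measurable_int (integrable_fubini_F (ih (i, j))).
apply: filterS2 aei H0 => x ix Hx.
apply: tb2 => //.
  exact: measurable_fun_pair2 mh.
move=> j.
rewrite -[LHS]fineK; last exact: integrable_fin_num.
by have := Hx j; rewrite /H => ->.
Qed.

End Total.

(** * Totality of the bumps with rational endpoints *)

Section BumpTotal.
Context {R : realType}.
Notation mu := (@lebesgue_measure R).

Definition bumpQ (i : rat * rat * nat) : R -> R := bump (ratr i.1.1) (ratr i.1.2) i.2.

Lemma test1_bumpQ i : test1 (bumpQ i).
Proof. by split; [exact: smooth_bump|exact: compact_supp_bump]. Qed.

Lemma test1_measurable (f : R -> R) : test1 f -> measurable_fun setT f.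
Proof. by move=> [/smooth_continuous cf _]; exact: continuous_measurable_fun. Qed.

Lemma expVN_ge (t : R) : 0 < t -> 1 - t^-1 <= expVN t.
Proof. by move=> t0; rewrite expVNE//; have := expR_ge1Dx (- t^-1). Qed.

Lemma cvg_bump (a b : R) (a_ b_ : R ^nat) : a_ @ \oo --> a -> b_ @ \oo --> b ->
  (forall n, a <= a_ n) -> (forall n, b_ n <= b) ->
  forall x, bump (a_ n) (b_ n) n x @[n --> \oo] --> (\1_(`]a, b[) x : R).
Proof.
move=> a_a b_b aa_ b_b' x; rewrite indicE.
rewrite mem_setE in_itv /=.
have [/andP[ax xb]|xab] := boolP (a < x < b); last first.
  apply: cvg_near_cst; apply: nearW => n; apply: bump_out.
  apply: contra xab => /andP[h1 h2].
  by rewrite (le_lt_trans (aa_ n) h1) (lt_le_trans h2 (b_b' n)).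
have lim1 (y : R) (y_ : R ^nat) : 0 < y -> y_ @ \oo --> y ->
    expVN (n.+1%:R * y_ n) @[n --> \oo] --> (1 : R).
  move=> y0 y_y.
  apply: (@squeeze_cvgr _ _ _ _ (fun n => 1 - 2 / y * n.+1%:R^-1) (cst 1)).
  - have /cvgrPdist_lt /(_ (y / 2)) := y_y.
    rewrite divr_gt0// => /(_ isT) hy; near=> n.
    have yn : y / 2 < y_ n.
      have : `|y - y_ n| < y / 2 by near: n.
      by rewrite ltr_distlC => /andP[h _]; lra.
    have yn0 : 0 < y_ n by rewrite (lt_trans _ yn)// divr_gt0.
    rewrite expVN_le1 andbT; apply: le_trans (expVN_ge _); last by rewrite mulr_gt0.
    rewrite lerD2l lerN2 invfM mulrC ler_wpM2r//.
    rewrite -[leRHS]invrK lef_pV2 ?posrE ?invr_gt0 ?divr_gt0// ?invf_div ?ltW//.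
  - rewrite -[X in _ --> X]subr0 -(mulr0 (2 / y)).
    apply: cvgB; first exact: cvg_cst.
    by apply: cvgM; [exact: cvg_cst|exact: cvg_harmonic].
  - exact: cvg_cst.
have xa : x - a_ n @[n --> \oo] --> x - a by apply: cvgB => //; exact: cvg_cst.
have bx : b_ n - x @[n --> \oo] --> b - x by apply: cvgB => //; exact: cvg_cst.
rewrite /= -[X in _ --> X]mul1r; apply: cvgM.
- by apply: lim1 xa; rewrite subr_gt0.
- by apply: lim1 bx; rewrite subr_gt0.
Unshelve. all: end_near. Qed.

(** A bump whose rational endpoints lie strictly outside [[a, b]] is bounded below there by a
    positive constant [c], so [|h|] is dominated by [c^-1] times an integrable product. *)
Lemma bumpQ_integrable_itv (h : R -> R) : measurable_fun setT h ->
  (forall i, mu.-integrable setT (fun x => (h x * bumpQ i x)%:E)) ->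
  forall a b : R, mu.-integrable `[a, b] (EFin \o h).
Proof.
move=> mh ih a b.
have [|r /=] := @rat_in_itvoo R (a - 1) a; first by rewrite ltrBlDr ltrDl.
rewrite in_itv /= => /andP[_ ra].
have [|s /=] := @rat_in_itvoo R b (b + 1); first by rewrite ltrDl.
rewrite in_itv /= => /andP[bs _].
pose c := expVN (a - ratr r) * expVN (ratr s - b).
have c0 : 0 < c by rewrite mulr_gt0// expVN_gt0// subr_gt0.
have := ih (r, s, 0%N).
move/(integrableZl measurableT c^-1)/(integrableS measurableT).
move=> /(_ `[a, b]%classic) H.
apply: (le_integrable _ _ _ (H _ _)) => //.
  by apply/measurable_EFinP; exact: measurable_funS mh.
move=> x; rewrite /= in_itv /= => /andP[ax xb].
rewrite lee_fin -[leLHS]mul1r -(mulVf (lt0r_neq0 c0)) (normrM c^-1) (normrM (h x)) -mulrA.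
rewrite (@gtr0_norm _ c^-1) ?invr_gt0//.
rewrite ler_wpM2l ?invr_ge0 ?(ltW c0)// mulrC ler_wpM2l//.
rewrite ger0_norm ?bump_ge0// /bumpQ /bump !mul1r.
by apply: ler_pM; rewrite ?expVN_ge0//; apply: expVN_homo => /=; lra.
Qed.

(** The endpoints are approached from inside by rationals while the bumps steepen; every bump is
    supported in [[a, b]] and at most 1, so [|h|] on []a, b[] is an integrable majorant. *)
Lemma bumpQ_integral_itv_eq0 (h : R -> R) : measurable_fun setT h ->
  (forall i, mu.-integrable setT (fun x => (h x * bumpQ i x)%:E)) ->
  (forall i, \int[mu]_x (h x * bumpQ i x)%:E = 0)%E ->
  forall a b : R, (\int[mu]_(x in `]a, b[) (h x)%:E = 0)%E.
Proof.
move=> mh ih h0 a b.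
have near_rat (y : R) n : {r : rat | y < ratr r < y + n.+1%:R^-1}.
  apply: cid; have [|r] := @rat_in_itvoo R y (y + n.+1%:R^-1).
    by rewrite ltrDl invr_gt0.
  by rewrite in_itv /=; exists r.
pose a_ n := sval (near_rat a n); pose b_ n := - sval (near_rat (- b) n).
have a_P n : a < ratr (a_ n) < a + n.+1%:R^-1 by rewrite /a_; case: (near_rat a n).
have b_P n : b - n.+1%:R^-1 < ratr (b_ n) < b.
  rewrite /b_; case: (near_rat (- b) n) => r /= /andP[h1 h2]; rewrite rmorphN /=.
  by apply/andP; split; move: (n.+1%:R^-1) h2 => t h2; lra.
have cvg_a : ratr (a_ n) @[n --> \oo] --> a.
  apply: (@squeeze_cvgr _ _ _ _ (cst a) (fun n => a + n.+1%:R^-1)).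
  - by apply: nearW => n; have /andP[h1 h2] := a_P n; rewrite !ltW.
  - exact: cvg_cst.
  - rewrite -[X in _ --> X]addr0; apply: cvgD; first exact: cvg_cst.
    exact: cvg_harmonic.
have cvg_b : ratr (b_ n) @[n --> \oo] --> b.
  apply: (@squeeze_cvgr _ _ _ _ (fun n => b - n.+1%:R^-1) (cst b)).
  - by apply: nearW => n; have /andP[h1 h2] := b_P n; rewrite !ltW.
  - rewrite -[X in _ --> X]subr0; apply: cvgB; first exact: cvg_cst.
    exact: cvg_harmonic.
  - exact: cvg_cst.
pose f_ n x := (h x * bumpQ (a_ n, b_ n, n) x)%:E.
have mf_ n : measurable_fun setT (f_ n).
  by apply/measurable_EFinP/measurable_funM => //; exact: test1_measurable (test1_bumpQ _).
have [] := @dominated_convergence _ _ _ mu `]a, b[%classic _ f_ (EFin \o h)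
  (fun x => `|(h x)%:E|)%E.
- by [].
- by move=> n; exact: measurable_funS (mf_ n).
- by apply/measurable_EFinP; exact: measurable_funS mh.
- apply: aeW => x xab; apply: cvg_EFin; first by apply: nearW.
  rewrite (_ : fine \o _ = fun n => h x * bumpQ (a_ n, b_ n, n) x)//.
  have : bump (ratr (a_ n)) (ratr (b_ n)) n x @[n --> \oo] --> (\1_(`]a, b[) x : R).
    apply: cvg_bump => // n.
      by have /andP[/ltW] := a_P n.
    by have /andP[_ /ltW] := b_P n.
  rewrite indicE mem_setE; move: xab; rewrite /= => -> /= h1.
  rewrite -[X in _ --> X]mulr1; apply: cvgM; [exact: cvg_cst|exact: h1].
- apply: integrable_abse; apply: integrableS (bumpQ_integrable_itv mh ih a b) => //.
  by apply: subset_itvW.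
- apply: aeW => x n _; rewrite /f_ lee_fin normrM ler_piMr//.
  by rewrite ger0_norm ?bump_ge0 ?bump_le1.
move=> _ _; rewrite (_ : [sequence _]_n = cst 0%E) => [|].
  by move/cvg_lim => <- //; rewrite lim_cst.
apply/funext => n /=; rewrite -[RHS](h0 (a_ n, b_ n, n)) integral_mkcond.
apply: eq_integral => x _; rewrite patchE mem_setE in_itv /=.
case: ifPn => // xab; rewrite /bumpQ bump_out ?mulr0//.
apply: contra xab => /andP[h1 h2].
have /andP[a1 _] := a_P n; have /andP[_ b1] := b_P n.
by rewrite (lt_trans a1 h1) (lt_trans h2 b1).
Qed.

(** The averages of [h] over all balls vanish, and [h] is locally integrable, so Lebesgue
    differentiation gives [h = 0] almost everywhere. *)
Lemma total_bumpQ : total_family mu bumpQ.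
Proof.
split.
- by move=> i; exact: test1_measurable (test1_bumpQ _).
- move=> x.
  have [|r /=] := @rat_in_itvoo R (x - 1) x; first by rewrite ltrBlDr ltrDl.
  rewrite in_itv /= => /andP[_ ra].
  have [|s /=] := @rat_in_itvoo R x (x + 1); first by rewrite ltrDl.
  rewrite in_itv /= => /andP[bs _].
  by exists (r, s, 0%N); rewrite gt_eqF// bump_gt0// ra.
move=> h mh ih h0.
have lh : locally_integrable setT h.
  split=> //; first exact: openT.
  move=> K _ cK.
  have [M [_ KM]] := compact_bounded cK.
  have /integrableP[_] := bumpQ_integrable_itv mh ih (- (M + 1)) (M + 1).
  apply: le_lt_trans; apply: ge0_subset_integral => //.
  - exact: compact_measurable.
  - by apply: measurable_funTS; do 2 apply: measurableT_comp => //.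
  - move=> x Kx; have := KM (M + 1); rewrite ltrDl => /(_ ltr01 x Kx) /=.
    by rewrite ler_norml /= in_itv.
pose E (x : R) (n : nat) := ball x (n.+1%:R^-1 : R).
have sE x : nicely_shrinking x (E x).
  split=> [n|]; first exact: measurable_ball.
  exists (1, fun n => (n.+1%:R^-1 : R)%:pos); split => //=.
  - exact: cvg_harmonic.
  - by move=> n; exact: subset_refl.
  - by move=> n; rewrite mul1e.
apply: aeS (lebesgue_differentiation lh) => x hx.
have := nice_lebesgue_differentiation sE lh hx.
rewrite (_ : (fun n => _) = cst 0%E) => [|].
  by move/(cvg_unique _ (@cvg_cst _ _ _ _ _)) => /(_ (@ereal_hausdorff R)) [].
by apply/funext => n; rewrite /E ball_itv bumpQ_integral_itv_eq0// mule0.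
Qed.

End BumpTotal.

(** * The one-dimensional sup inequality *)

Section SupInequality.
Context {R : realType}.
Notation mu := (@lebesgue_measure R).
Local Open Scope ereal_scope.

(* [g] controls the oscillation of [U]; going back from [s] to the last point
   where |U| <= |U s| / 2, the oscillation is paid on a set where |U| is at
   least |U s| / 2. *)
Lemma sup_le_of_oscillation (U u g : R -> R) :
  measurable_fun setT u -> measurable_fun setT g ->
  \int[mu]_x (u x ^+ 2)%:E < +oo -> \int[mu]_x (g x ^+ 2)%:E < +oo ->
  {ae mu, forall x, u x = U x} ->
  (forall t s, (t <= s)%R ->
     `|U s - U t|%:E <= \int[mu]_(x in `[t, s]) `|g x|%:E) ->
  forall s, (U s ^+ 2)%:E <= 4%:E * \int[mu]_x (`|u x| * `|g x|)%:E.
Proof.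
move=> mu_ mg u2 g2 uU osc s.
have [Us0|Us0] := eqVneq (U s) 0%R.
  rewrite Us0 expr0n/=; apply: mule_ge0 => //; apply: integral_ge0 => x _.
  by rewrite lee_fin mulr_ge0.
pose M := `|U s|%R; have M0 : (0 < M)%R by rewrite normr_gt0.
pose A := [set t | (t <= s)%R /\ (`|U t| <= M / 2)%R].
(* Otherwise [|u|] would exceed [M / 2] almost everywhere on a half-line, against square
   integrability. *)
have A0 : A !=set0.
  apply: contrapT => nA.
  have UA t : (t <= s)%R -> (M / 2 < `|U t|)%R.
    by move=> ts; rewrite ltNge; apply/negP => Ut; apply: nA; exists t.
  move: u2; apply/negP; rewrite -leNgt.
  apply: (@le_trans _ _ (\int[mu]_(x in `]-oo, s]) ((M / 2) ^+ 2)%:E)).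
    rewrite integral_cst//= lebesgue_measure_itv/= ltNyr addey// gt0_muley//.
    by rewrite lte_fin exprn_gt0// divr_gt0.
  have mu2 : measurable_fun setT (fun x => (u x ^+ 2)%:E).
    by apply/measurable_EFinP; exact: measurable_funX.
  apply: (@le_trans _ _ (\int[mu]_(x in `]-oo, s]) (u x ^+ 2)%:E)).
    apply: ae_ge0_le_integral => //.
    - by move=> x _; rewrite lee_fin sqr_ge0.
    - by move=> x _; rewrite lee_fin sqr_ge0.
    - exact: measurable_funTS.
    apply: aeS uU => x ux /=; rewrite in_itv /= => xs.
    rewrite lee_fin -(real_normK (num_real (u x))) lerXn2r ?nnegrE ?divr_ge0 ?(ltW M0)//.
    by rewrite ux; apply: ltW; exact: UA.
  apply: ge0_subset_integral => // x _.
  by rewrite lee_fin sqr_ge0.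
have supA : has_sup A by split => //; exists s => t [].
pose ts := sup A.
have tss : (ts <= s)%R by apply: ge_sup => // t [].
have above x : (ts < x)%R -> (x <= s)%R -> (M / 2 < `|U x|)%R.
  move=> tx xs; rewrite ltNge; apply/negP => Ux; move: tx; rewrite ltNge => /negP.
  by apply; apply: ub_le_sup => //; case: supA.
have mg1 D : measurable_fun D (fun x => `|g x|%:E).
  by apply: measurable_funTS; apply/measurable_EFinP; exact: measurableT_comp.
have half : (M / 2)%:E <= \int[mu]_(x in `[ts, s]) `|g x|%:E.
  apply/lee_addgt0Pr => e e0.
  pose G := fine (\int[mu]_x (g x ^+ 2)%:E).
  have G0 : (0 <= G)%R.
    by apply: fine_ge0; apply: integral_ge0 => x _; rewrite lee_fin sqr_ge0.
  have GE : G%:E = \int[mu]_x (g x ^+ 2)%:E.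
    by rewrite fineK// ge0_fin_numE//; apply: integral_ge0 => x _; rewrite lee_fin sqr_ge0.
  (* The supremum [ts] need not belong to [A], so a point [t] of [A] slightly to its left is used,
     and the extra integral of [|g|] over [[t, ts[] must be small. From [|g| <= d g^2 + 1 / d] it is
     at most [d G + (ts - t) / d]; this [d] makes the first term at most [e / 2], and
     [ts - t <= d e / 2] does so for the second. *)
  pose d := (e / 2 / (G + 1))%R.
  have d0 : (0 < d)%R by rewrite !divr_gt0// ltr_wpDl.
  have ed0 : (0 < e / 2 * d)%R by rewrite mulr_gt0// divr_gt0.
  have [t [tle Ut] tt] := sup_adherent ed0 supA.
  have tts : (t <= ts)%R by apply: ub_le_sup => //; case: supA.
  have h1 : (M / 2)%:E <= \int[mu]_(x in `[t, s]) `|g x|%:E.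
    apply: le_trans (osc t s tle); rewrite lee_fin.
    apply: le_trans (lerB_dist _ _); rewrite -/M; lra.
  apply: (le_trans h1).
  have -> : `[t, s]%classic = (`[t, ts[ `|` `[ts, s])%classic :> set R.
    by rewrite -itv_bndbnd_setU// bnd_simp.
  rewrite ge0_integral_setU//=; first last.
  - apply/disj_setPS => x []; rewrite /= !in_itv /= => /andP[_ h2] /andP[h3 _].
    by move: (lt_le_trans h2 h3); rewrite ltxx.
  - exact: mg1.
  rewrite addeC leeD2l//.
  have gd x : (`|g x| <= d * g x ^+ 2 + d^-1)%R.
    rewrite -(real_normK (num_real (g x))).
    have [gxd|gxd] := leP `|g x|%R (d^-1)%R.
      by apply: (le_trans gxd); rewrite lerDr mulr_ge0 ?sqr_ge0 ?ltW.
    apply: (@le_trans _ _ (d * `|g x| ^+ 2)%R); last by rewrite lerDl invr_ge0 ltW.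
    rewrite expr2 mulrA ler_peMl// -(mulfV (lt0r_neq0 d0)).
    by apply: ler_wpM2l; exact: ltW.
  have mg2 : measurable_fun setT (fun x => (g x ^+ 2)%:E).
    by apply/measurable_EFinP; exact: measurable_funX.
  apply: (@le_trans _ _ (\int[mu]_(x in `[t, ts[) (d%:E * (g x ^+ 2)%:E + (d^-1)%:E))).
    apply: ge0_le_integral => //.
    - exact: mg1.
    - apply: emeasurable_funD => //; apply: emeasurable_funM => //.
      exact: measurable_funTS.
    - by move=> x _; rewrite lee_fin.
  rewrite ge0_integralD//; last 3 first.
  - by move=> x _; rewrite -EFinM lee_fin mulr_ge0 ?sqr_ge0// ltW.
  - by apply: emeasurable_funM => //; exact: measurable_funTS.
  - by move=> x _; rewrite lee_fin invr_ge0 ltW.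
  rewrite integral_cst//= lebesgue_measure_itv/=.
  rewrite (splitr e) EFinD leeD//.
    rewrite ge0_integralZl_EFin//; last 3 first.
    - by move=> x _; rewrite lee_fin sqr_ge0.
    - exact: measurable_funTS.
    - exact: ltW.
    apply: (@le_trans _ _ (d%:E * G%:E)).
      rewrite lee_pmul2l ?lte_fin// GE; apply: ge0_subset_integral => // x _.
      by rewrite lee_fin sqr_ge0.
    rewrite -EFinM lee_fin /d mulrAC ler_pdivrMr ?ltr_wpDl//.
    by apply: ler_wpM2l; [rewrite divr_ge0// ltW|rewrite lerDl].
  case: ifPn => _; last by rewrite mule0 lee_fin divr_ge0// ltW.
  rewrite -EFinB -EFinM lee_fin mulrC ler_pdivrMr//.
  by rewrite lerBlDl -lerBlDr ltW.
have claim : (M / 2)%:E * \int[mu]_(x in `[ts, s]) `|g x|%:E <=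
    \int[mu]_x (`|u x| * `|g x|)%:E.
  have mug : measurable_fun setT (fun x => (`|u x| * `|g x|)%:E).
    by apply/measurable_EFinP; apply: measurable_funM; exact: measurableT_comp.
  rewrite -integral_itv_obnd_cbnd; last exact: mg1.
  rewrite -ge0_integralZl_EFin ?divr_ge0 ?(ltW M0)//; last exact: mg1.
  apply: (@le_trans _ _ (\int[mu]_(x in `]ts, s]) (`|u x| * `|g x|)%:E)).
    apply: ae_ge0_le_integral => //.
    - by move=> x _; rewrite -EFinM lee_fin mulr_ge0// divr_ge0// ltW.
    - by apply: emeasurable_funM => //; exact: mg1.
    - exact: measurable_funTS.
    apply: aeS uU => x ux /=; rewrite in_itv /= => /andP[tx xs].
    by rewrite -EFinM lee_fin ler_wpM2r// ux ltW// above.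
  by apply: ge0_subset_integral.
rewrite -(real_normK (num_real (U s))) -/M.
(* The constant 4: one factor [M / 2] is the lower bound of [|u|] on the interval, the other is the
   oscillation paid there. *)
have -> : (M ^+ 2 = 4 * (M / 2 * (M / 2)))%R by field.
rewrite EFinM lee_pmul2l ?lte_fin//.
apply: le_trans claim.
by rewrite EFinM lee_pmul2l ?lte_fin ?divr_gt0.
Qed.
End SupInequality.

(** * Products of square-integrable functions, and integrable tensor products *)

Section SquareIntegrable.
Context d (T : measurableType d) {R : realType} (m : {measure set T -> \bar R}).
Local Open Scope ereal_scope.

Lemma integrable_sq (h : T -> R) : measurable_fun setT h ->
  \int[m]_x (h x ^+ 2)%:E < +oo -> m.-integrable setT (fun x => (h x ^+ 2)%:E).
Proof.
move=> mh h2; apply/integrableP; split.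
  by apply/measurable_EFinP; exact: measurable_funX.
by under eq_integral do rewrite gee0_abs ?lee_fin ?sqr_ge0//.
Qed.

Lemma integrable_mul_sq (f g : T -> R) :
  measurable_fun setT f -> measurable_fun setT g ->
  \int[m]_x (f x ^+ 2)%:E < +oo -> \int[m]_x (g x ^+ 2)%:E < +oo ->
  m.-integrable setT (fun x => (f x * g x)%:E).
Proof.
move=> mf mg f2 g2.
have := integrableD measurableT (integrable_sq mf f2) (integrable_sq mg g2).
apply: le_integrable => //; first by apply/measurable_EFinP; exact: measurable_funM.
move=> x _; rewrite /= lee_fin [leRHS]ger0_norm ?addr_ge0 ?sqr_ge0// normrM.
rewrite -(real_normK (num_real (f x))) -(real_normK (num_real (g x))).
set a := `|f x|%R; set b := `|g x|%R.
have a0 : (0 <= a)%R by rewrite normr_ge0.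
have b0 : (0 <= b)%R by rewrite normr_ge0.
have := sqr_ge0 (a - b)%R; nra.
Qed.

End SquareIntegrable.

Lemma integrable_prod_mul d1 d2 (T1 : measurableType d1) (T2 : measurableType d2)
    {R : realType} (m1 : {sigma_finite_measure set T1 -> \bar R})
    (m2 : {sigma_finite_measure set T2 -> \bar R}) (f : T1 -> R) (g : T2 -> R) :
  m1.-integrable setT (EFin \o f) -> m2.-integrable setT (EFin \o g) ->
  (m1 \x m2)%E.-integrable setT (fun z => (f z.1 * g z.2)%:E).
Proof.
move=> fi gi; have /integrableP[/measurable_EFinP mf fo] := fi.
have /integrableP[/measurable_EFinP mg go] := gi.
have mK : measurable_fun setT (fun z : T1 * T2 => (f z.1 * g z.2)%:E).
  apply/measurable_EFinP/measurable_funM.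
    exact: measurableT_comp mf measurable_fst.
  exact: measurableT_comp mg measurable_snd.
apply: (proj2 (integrable12ltyP m1 m2 mK)).
have mg' : measurable_fun setT (fun y => `|g y|%:E).
  by apply/measurable_EFinP; exact: measurableT_comp.
have mf' : measurable_fun setT (fun y => `|f y|%:E).
  by apply/measurable_EFinP; exact: measurableT_comp.
under eq_integral => x _.
  rewrite (eq_integral (fun y => `|f x|%:E * `|g y|%:E)%E); last first.
    by move=> y _; rewrite /= normrM EFinM.
  rewrite ge0_integralZl_EFin//.
  over.
rewrite ge0_integralZr//; last first.
  by apply: integral_ge0.
by rewrite lte_mul_pinfty// ?ge0_fin_numE ?integral_ge0.
Qed.

(** * A kernel for primitives on the line *)

Section Kappa.
Context {R : realType}.
Notation mu := (@lebesgue_measure R).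

Lemma test1_mul f g : test1 f -> test1 g -> test1 (f \* g : R -> R).
Proof.
move=> [sf [L hL]] [sg _]; split; first by move=> k; apply: Dk_mul.
by exists L => x /hL /= ->; rewrite mul0r.
Qed.

Lemma test1_sq (f : R -> R) : test1 f -> (\int[mu]_x (f x ^+ 2)%:E < +oo)%E.
Proof.
move=> tf; have /integrableP[_] := test1_integrable (test1_mul tf tf).
apply: le_lt_trans; rewrite le_eqVlt; apply/orP; left; apply/eqP.
apply: eq_integral => x _; rewrite gee0_abs ?lee_fin; last by rewrite /= -expr2 sqr_ge0.
by rewrite /= expr2.
Qed.

Lemma test1_derive1 (f : R -> R) : test1 f -> test1 (derive1 f).
Proof.
move=> [sf [L hL]]; split; first exact: smooth_derive1.
exists (L + 1) => x Lx; rewrite derive1E.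
rewrite (@near_eq_derive _ _ _ f (cst 0)) ?derive_cst//.
have x0 : L < `|x| by rewrite (lt_le_trans _ Lx)// ltrDl.
near=> y; apply: hL; apply: ltW; near: y.
apply: (@cvgr_gt _ _ _ _ (fun y : R => `|y|) _ _ _ x0); exact: norm_continuous.
Unshelve. all: end_near. Qed.

Lemma test1_integral_itvNy (psi : R -> R) y : test1 psi ->
  (\int[mu]_(x in `]-oo, y]) (derive1 psi x)%:E = (psi y)%:E)%E.
Proof.
move=> tp; have [sp [L hL]] := tp; have [_ [L' hL']] := test1_derive1 tp.
(* A point strictly to the left of [y] beyond which both [psi] and its derivative vanish. *)
pose A := Num.min (- `|L|) (Num.min (- `|L'|) (y - 1)).
have AL : A <= - `|L| by rewrite ge_min lexx.
have AL' : A <= - `|L'| by rewrite !ge_min lexx orbT.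
have Ay : A < y by rewrite !gt_min ltrBlDr ltrDl ltr01 !orbT.
rewrite integral_mkcond (_ : _ \_ _ = (EFin \o derive1 psi) \_ `[A, y]); last first.
  apply/funext => x; rewrite !patchE !mem_setE !in_itv /=.
  case: ifPn => xy; rewrite ?andbT ?andbF //.
  case: ifPn => //; rewrite -ltNge => xA /=; congr EFin; apply: hL'.
  have x0 : x <= 0 by rewrite (le_trans (ltW xA))// (le_trans AL)// oppr_le0.
  rewrite ler0_norm// lerNr (le_trans (ltW xA))// (le_trans AL')// lerN2.
  exact: ler_norm.
rewrite -integral_mkcond (@continuous_FTC2 _ _ psi _ _ Ay).
- rewrite (hL A) ?sube0// ler0_norm ?(le_trans AL) ?oppr_le0//.
  by rewrite lerNr (le_trans AL)// lerN2 ler_norm.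
- exact/continuous_subspaceT/smooth_continuous/smooth_derive1.
- split.
  + by move=> x _; have [] := smooth_is_derive sp x.
  + by apply: cvg_at_right_filter; exact: smooth_continuous.
  + by apply: cvg_at_left_filter; exact: smooth_continuous.
- by [].
Qed.

Lemma test1_integral_derive1 (psi : R -> R) : test1 psi ->
  (\int[mu]_x (derive1 psi x)%:E = 0)%E.
Proof.
move=> tp; have [_ [L hL]] := tp; have [_ [L' hL']] := test1_derive1 tp.
pose y := Num.max L L'.
have yL : psi `|y| = 0 by apply: hL; rewrite normr_id (le_trans _ (ler_norm _))// le_max lexx.
rewrite -[RHS](congr1 EFin yL) -test1_integral_itvNy// [RHS]integral_mkcond.
apply: eq_integral => x _; rewrite patchE mem_setE in_itv /=.
case: ifPn => //; rewrite -ltNge => xy; congr EFin; apply: hL'.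
apply: le_trans (ler_norm x); apply: le_trans (ltW xy).
by rewrite (le_trans _ (ler_norm y))// le_max lexx orbT.
Qed.

(* [\int g(y) kap s y dy] is the primitive of [g] vanishing at 0. *)
Definition kap (s y : R) : R := (0 <= y)%R%:R - (s <= y)%R%:R.

Lemma kap_out s y : `|s| < `|y| -> kap s y = 0.
Proof.
rewrite /kap; have [y0|y0] := leP 0 y.
  rewrite (ger0_norm y0) => sy.
  by rewrite (ltW (le_lt_trans (ler_norm s) sy)) subrr.
rewrite (ltr0_norm y0) => sy.
have h : - s < - y by rewrite (le_lt_trans _ sy)// -normrN ler_norm.
by rewrite leNgt (_ : y < s) ?subrr// -ltrN2.
Qed.

Lemma normr_kap_le1 s y : `|kap s y| <= 1.
Proof.
by rewrite /kap; case: (0 <= y); case: (s <= y);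
  rewrite ?subr0 ?subrr ?sub0r ?normrN ?normr0 ?normr1.
Qed.

Lemma measurable_kap : measurable_fun setT (fun z : R * R => kap z.1 z.2).
Proof.
have mb (b : R * R -> bool) : measurable_fun setT b ->
    measurable_fun setT (fun z => (b z)%:R : R).
  move=> mb; rewrite (_ : (fun _ => _) = fun z => if b z then 1 else 0); last first.
    by apply/funext => z; case: (b z).
  exact: measurable_fun_ifT.
apply: measurable_funB; apply: mb; apply: measurable_fun_ler => //.
Qed.

(** The term of [kap] independent of [s] contributes nothing because [derive1 psi] has zero mean;
    the other integrates it over []-oo, y]]. After Fubini this identity is integration by parts
    against a primitive. *)
Lemma test1_integral_kap (psi : R -> R) y : test1 psi ->
  (\int[mu]_s (derive1 psi s * kap s y)%:E = (- psi y)%:E)%E.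
Proof.
move=> tp; have ip := test1_integrable (test1_derive1 tp).
transitivity (\int[mu]_s (((0 <= y)%R%:R)%:E * (derive1 psi s)%:E
   - ((EFin \o derive1 psi) \_ `]-oo, y]) s))%E.
  apply: eq_integral => s _; rewrite patchE mem_setE in_itv /= /kap.
  by case: (0 <= y); case: (s <= y) => /=;
    rewrite -?EFinN -?EFinM -?EFinD ?sube0 -?EFinM; congr EFin; ring.
rewrite integralB//; last 2 first.
- exact: integrableZl.
- apply: (proj1 (integrable_mkcond (mu := mu) _ _)) => //.
  exact: integrableS ip.
rewrite integralZl// test1_integral_derive1// mule0 sub0e -integral_mkcond.
by rewrite test1_integral_itvNy.
Qed.

End Kappa.

(** * Primitives of square-integrable functions on the line *)

Section WeakLine.
Context {R : realType}.
Notation mu := (@lebesgue_measure R).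

Lemma test1_scale (c : R) f : test1 f -> test1 (fun x => c * f x : R).
Proof.
move=> [sf [L hL]]; split; last by exists L => x /hL ->; rewrite mulr0.
by move=> k; apply: (@Dk_mul _ k (cst c)); [exact: Dk_cst|exact: sf].
Qed.

Lemma test1_add f g : test1 f -> test1 g -> test1 (fun x => f x + g x : R).
Proof.
move=> [sf [L hL]] [sg [M hM]]; split; first by move=> k; exact: Dk_add.
exists (Num.max L M) => x; rewrite ge_max => /andP[/hL -> /hM ->].
by rewrite addr0.
Qed.

(** If all these integrals vanished, totality applied to the constant 1 would make it null. *)
Lemma bumpQ_integral_neq0 : exists i, \int[mu]_x bumpQ i x != 0.
Proof.
apply: contrapT => n0.
have b0 i : \int[mu]_x bumpQ i x = 0.
  by apply: contrapT => /eqP h; apply: n0; exists i.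
have [_ _] := @total_bumpQ R => /(_ (cst 1)) h.
have : {ae mu, forall x : R, (cst 1 x : R) = 0}.
  apply: h => //.
  - move=> i; rewrite (_ : (fun x => _) = EFin \o bumpQ i).
      exact: test1_integrable (test1_bumpQ i).
    by apply/funext => x; rewrite /= mul1r.
  - move=> i; under eq_integral do rewrite /= mul1r.
    have := b0 i; rewrite /Rintegral.
    have fi : (\int[mu]_x (bumpQ i x)%:E)%E \is a fin_num.
      exact: integrable_fin_num (test1_integrable (test1_bumpQ i)).
    by rewrite -{2}(fineK fi) => ->.
move=> [N [mN N0 sN]].
have : (mu [set: R] <= mu N)%E.
  apply: le_measure; rewrite ?inE//.
  by apply: subset_trans sN => x _ /eqP; rewrite oner_eq0.
by rewrite N0 -set_itvNyy lebesgue_measure_itv.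
Qed.

(** The du Bois-Reymond correction: subtracting a multiple of one fixed [eta] gives each bump zero
    mean, hence a compactly supported primitive. Testing a weak derivative against the countably
    many [psi i] then amounts to testing against all bumps modulo one constant. *)
Lemma mean_zero_primitives : exists (eta : R -> R) (psi : rat * rat * nat -> R -> R),
  [/\ test1 eta, \int[mu]_x eta x = 1, forall i, test1 (psi i) &
   forall i, derive1 (psi i) = fun x => bumpQ i x - (\int[mu]_t bumpQ i t) * eta x].
Proof.
have [i0 I0] := bumpQ_integral_neq0.
pose c0 := \int[mu]_x bumpQ i0 x; pose eta x := c0^-1 * bumpQ i0 x.
have teta : test1 eta by apply: test1_scale; exact: test1_bumpQ.
have ieta : \int[mu]_x eta x = 1.
  by rewrite RintegralZl ?mulVf//; exact: test1_integrable (test1_bumpQ i0).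
have H i : {psi | test1 psi &
    derive1 psi = fun x => bumpQ i x - (\int[mu]_t bumpQ i t) * eta x}.
  apply: cid2; apply: test1_primitive.
    rewrite (_ : (fun x => _) = (fun x => bumpQ i x + (- \int[mu]_t bumpQ i t) * eta x)).
      by apply: test1_add; [exact: test1_bumpQ|exact: test1_scale].
    by apply/funext => x; rewrite mulNr.
  have ib := test1_integrable (test1_bumpQ i).
  have ie := test1_integrable teta.
  rewrite RintegralB//; last exact: test1_integrable (test1_scale _ teta).
  by rewrite RintegralZl// ieta mulr1 subrr.
exists eta, (fun i => s2val (H i)); split => // i.
- exact: (s2valP (H i)).
- exact: (s2valP' (H i)).
Qed.

Section Primitive.
Variable g : R -> R.
Hypotheses (mg : measurable_fun setT g) (g2 : (\int[mu]_x (g x ^+ 2)%:E < +oo)%E).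

Let P s := \int[mu]_y (g y * kap s y).

Lemma sq_integrable_itv (a b : R) : mu.-integrable `[a, b] (EFin \o g).
Proof.
have mI : measurable (`[a, b]%classic : set (measurableTypeR R)) by [].
have i1 : mu.-integrable `[a, b] (cst 1%:E).
  apply/integrableP; split => //.
  under eq_integral do rewrite /= normr1.
  rewrite integral_cst//= mul1e lebesgue_measure_itv /=.
  by case: ifPn => _; rewrite -?EFinB ltry.
have i2 : mu.-integrable `[a, b] (fun x => (g x ^+ 2)%:E).
  apply: (@integrableS _ _ _ mu setT) => //.
  exact: integrable_sq.
have := integrableD mI i1 i2.
apply: le_integrable => //; first by apply/measurable_EFinP; exact: measurable_funTS.
move=> x _; rewrite lee_fin /= [leRHS]ger0_norm ?addr_ge0 ?sqr_ge0//.
rewrite -(real_normK (num_real (g x))).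
have := sqr_ge0 (`|g x| - 1); nra.
Qed.

Lemma measurable_mul_kap s : measurable_fun setT (fun y => (g y * kap s y)%:E).
Proof.
apply/measurable_EFinP/measurable_funM => //.
exact: (measurable_fun_pair2 s measurable_kap).
Qed.

Lemma integrable_mul_kap s : mu.-integrable setT (fun y => (g y * kap s y)%:E).
Proof.
have := sq_integrable_itv (- `|s|) `|s|.
move/(proj1 (integrable_mkcond (mu := mu) _ (measurable_itv _))).
apply: le_integrable => //; first exact: measurable_mul_kap.
move=> y _; rewrite patchE mem_setE in_itv /= -ler_norml.
case: ifPn => [_|]; first by rewrite lee_fin normrM ler_piMr// normr_kap_le1.
by rewrite -ltNge => h; rewrite (kap_out h) mulr0 normr0; exact: abse_ge0.
Qed.

Lemma primitive_osc t s : t <= s ->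
  (`|P s - P t|%:E <= \int[mu]_(x in `[t, s]) `|g x|%:E)%E.
Proof.
move=> ts.
rewrite /P -RintegralB//; try exact: integrable_mul_kap.
have ii : mu.-integrable setT (fun y => (g y * kap s y - g y * kap t y)%:E).
  exact: (integrableB measurableT (integrable_mul_kap s) (integrable_mul_kap t)).
rewrite EFin_normr_Rintegral//.
apply: le_trans (le_abse_integral mu measurableT _) _.
  by case/integrableP : ii.
rewrite [leRHS]integral_mkcond; apply: ge0_le_integral => //.
- by case/integrableP : ii => mi _; exact: measurableT_comp.
- apply/measurable_restrict => //; apply: measurable_funTS.
  by apply/measurable_EFinP; exact: measurableT_comp.
move=> y _; rewrite patchE mem_setE in_itv /= -mulrBr normrM.
(* For [t <= s] this difference is the indicator of [[t, s[]. *)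
have -> : kap s y - kap t y = (t <= y)%R%:R - (s <= y)%R%:R by rewrite /kap; ring.
case: (leP t y) => ty; case: (leP s y) => sy;
  rewrite ?subrr ?normr0 ?mulr0 ?subr0 ?normr1 ?mulr1 //=.
- by case: ifPn => _; rewrite ?lee_fin//; exact: lexx.
- by rewrite (ltW sy) /=.
- by move: (le_lt_trans ts (le_lt_trans sy ty)); rewrite ltxx.
Qed.

(** [phi] vanishes for [|s| >= L] and [kap s y] for [|y| > |s|], so only [|y| <= L] matters and [g]
    may be replaced by its restriction to [[-L, L]], which is integrable. This licenses Fubini in
    [primitive_by_parts]. *)
Lemma integrable_test1_kap (phi : R -> R) : test1 phi ->
  (mu \x mu)%E.-integrable setT
     (fun z : measurableTypeR R * measurableTypeR R =>
        (phi z.1 * (g z.2 * kap z.1 z.2))%:E).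
Proof.
move=> tphi; have [_ [L hL]] := tphi.
have ig : mu.-integrable setT (EFin \o (g \_ `[- L, L])).
  rewrite -restrict_EFin.
  exact: (proj1 (integrable_mkcond (mu := mu) _ (measurable_itv _))) (sq_integrable_itv _ _).
apply: le_integrable (integrable_prod_mul (test1_integrable tphi) ig) => //.
  apply/measurable_EFinP; apply: measurable_funM.
    exact: measurableT_comp (test1_measurable tphi) measurable_fst.
  apply: measurable_funM; last exact: measurable_kap.
  exact: measurableT_comp mg measurable_snd.
move=> [s y] _ /=; rewrite lee_fin.
have [sL|Ls] := ltP `|s| L; last by rewrite hL// !mul0r.
rewrite !normrM ler_wpM2l// patchE mem_setE in_itv /= -ler_norml.
case: ifPn => [_|]; first by rewrite ler_piMr// normr_kap_le1.
by rewrite -ltNge => /(lt_trans sL)/kap_out ->; rewrite normr0 mulr0.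
Qed.

Lemma inner_test1_kap (phi : R -> R) s :
  (\int[mu]_y (phi s * (g y * kap s y))%:E = (phi s * P s)%:E)%E.
Proof.
under eq_integral do rewrite EFinM.
rewrite integralZl//; last exact: integrable_mul_kap.
by rewrite EFinM /P /Rintegral fineK//; exact: integrable_fin_num (integrable_mul_kap s).
Qed.

Lemma primitive_test1_integrable (phi : R -> R) : test1 phi ->
  mu.-integrable setT (fun s => (phi s * P s)%:E).
Proof.
move=> tphi; have := integrable_fubini_F (integrable_test1_kap tphi).
by rewrite /fubini_F; under eq_fun do rewrite inner_test1_kap.
Qed.

Lemma measurable_primitive : measurable_fun setT P.
Proof.
apply: (measurableT_comp (@fine_measurable _ _ measurableT)).
apply: (@measurable_fubini_integral R _ _ _ _ mu
  (fun z : measurableTypeR R * measurableTypeR R => (g z.2 * kap z.1 z.2)%:E)).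
apply/measurable_EFinP/measurable_funM; last exact: measurable_kap.
exact: measurableT_comp mg measurable_snd.
Qed.

Lemma primitive_by_parts (psi : R -> R) : test1 psi ->
  (\int[mu]_s (derive1 psi s * P s)%:E = - \int[mu]_y (g y * psi y)%:E)%E.
Proof.
move=> tpsi; have tphi := test1_derive1 tpsi.
have iK := integrable_test1_kap tphi.
have igp : mu.-integrable setT (fun y => (g y * psi y)%:E).
  by apply: integrable_mul_sq => //; [exact: test1_measurable|exact: test1_sq].
rewrite -mulN1e -integralZl//.
transitivity (\int[mu]_s \int[mu]_y (derive1 psi s * (g y * kap s y))%:E)%E.
  by apply: eq_integral => s _; rewrite (inner_test1_kap (derive1 psi)).
rewrite [LHS](integral12_prod_meas1 iK) -(integral21_prod_meas1 iK).
apply: eq_integral => y _; rewrite /fubini_G.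
transitivity (\int[mu]_s ((g y)%:E * (derive1 psi s * kap s y)%:E))%E.
  by apply: eq_integral => s _; rewrite -EFinM; congr EFin => /=; ring.
rewrite integralZl//; last first.
  have := test1_integrable tphi; apply: le_integrable => //.
    apply/measurable_EFinP/measurable_funM; first exact: test1_measurable.
    exact: (measurable_fun_pair1 y measurable_kap).
  by move=> s _; rewrite lee_fin normrM ler_piMr// normr_kap_le1.
by rewrite test1_integral_kap// -!EFinM mulrN mulN1r.
Qed.

End Primitive.

End WeakLine.

(** * From a weak derivative on the line to the supremum bound *)

Section WeakSup.
Context {R : realType}.
Notation mu := (@lebesgue_measure R).
Variables (eta : R -> R) (psi : rat * rat * nat -> R -> R).
Hypotheses (teta : test1 eta) (tpsi : forall i, test1 (psi i))
  (dpsi : forall i, derive1 (psi i) =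
     fun x => bumpQ i x - (\int[mu]_t bumpQ i t) * eta x).

(** With [P] the primitive of [g], the difference [w = u - P] is orthogonal to every
    [derive1 (psi i)]. By the choice of these functions, [w - C] with [C = \int w eta] is orthogonal
    to all bumps, so [u = C + P] almost everywhere, and [C + P] oscillates by at most the integral
    of [|g|]. *)
Lemma weak_derivative_sup (u g : R -> R) :
  measurable_fun setT u -> measurable_fun setT g ->
  (\int[mu]_x (u x ^+ 2)%:E < +oo)%E -> (\int[mu]_x (g x ^+ 2)%:E < +oo)%E ->
  (forall i, \int[mu]_x (u x * derive1 (psi i) x)%:E
     = - \int[mu]_x (g x * psi i x)%:E)%E ->
  {ae mu, forall s, ((u s ^+ 2)%:E <= 4%:E * \int[mu]_x (`|u x| * `|g x|)%:E)%E}.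
Proof.
move=> mu_ mg u2 g2 ug.
pose P s := \int[mu]_y (g y * kap s y).
pose w s := u s - P s.
have mP : measurable_fun setT P := measurable_primitive mg.
have mw : measurable_fun setT w by exact: measurable_funB.
have iu f : test1 f -> mu.-integrable setT (fun x => (u x * f x)%:E).
  by move=> tf; apply: integrable_mul_sq => //; [exact: test1_measurable|exact: test1_sq].
have iP f : test1 f -> mu.-integrable setT (fun x => (f x * P x)%:E).
  exact: primitive_test1_integrable.
have iwE f : (fun x => (w x * f x)%:E) = (fun x => (u x * f x)%:E - (f x * P x)%:E)%E.
  by apply/funext => x; rewrite -EFinB; congr EFin; rewrite /w; ring.
have iw f : test1 f -> mu.-integrable setT (fun x => (w x * f x)%:E).
  by move=> tf; rewrite iwE; apply: (integrableB measurableT (iu _ tf) (iP _ tf)).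
pose C := \int[mu]_x (w x * eta x).
have CE : (\int[mu]_x (w x * eta x)%:E = C%:E)%E.
  by rewrite /C /Rintegral fineK//; exact: integrable_fin_num (iw _ teta).
have IbE i : (\int[mu]_x (bumpQ i x)%:E = (\int[mu]_x bumpQ i x)%:E)%E.
  rewrite /Rintegral fineK//.
  exact: integrable_fin_num (test1_integrable (test1_bumpQ i)).
have wpsi i : (\int[mu]_x (w x * derive1 (psi i) x)%:E = 0)%E.
  have tp := test1_derive1 (tpsi i).
  rewrite iwE.
  rewrite (integralB measurableT (iu _ tp) (iP _ tp)) ug primitive_by_parts//.
  rewrite oppeK addeC subee//.
  apply: integrable_fin_num => //; apply: integrable_mul_sq => //.
    exact: test1_measurable.
  exact: test1_sq.
have wb i : (\int[mu]_x (w x * bumpQ i x)%:E = (\int[mu]_x bumpQ i x * C)%:E)%E.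
  have h := wpsi i; rewrite dpsi in h.
  have E : (fun x => (w x * (bumpQ i x - (\int[mu]_t bumpQ i t) * eta x))%:E)
      = (fun x => (w x * bumpQ i x)%:E
           - (\int[mu]_t bumpQ i t)%:E * (w x * eta x)%:E)%E.
    by apply/funext => x; rewrite -EFinM -EFinB; congr EFin; ring.
  move: h; rewrite E (integralB measurableT (iw _ (test1_bumpQ i))
    (integrableZl measurableT _ (iw _ teta))).
  rewrite (integralZl measurableT (iw _ teta)) CE -EFinM => /eqP.
  by rewrite sube_eq ?add0e; [move/eqP|
    exact: integrable_fin_num (iw _ (test1_bumpQ i))|].
have dE i : (fun x => ((w x - C) * bumpQ i x)%:E) =
    (fun x => (w x * bumpQ i x)%:E - C%:E * (bumpQ i x)%:E)%E.
  by apply/funext => x; rewrite -EFinM -EFinB; congr EFin; ring.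
have ib i := test1_integrable (test1_bumpQ (R := R) i).
have wC : {ae mu, forall x, w x - C = 0}.
  have [_ _] := @total_bumpQ R; apply.
  - exact: measurable_funB.
  - move=> i; rewrite dE.
    exact: (integrableB measurableT (iw _ (test1_bumpQ i)) (integrableZl measurableT _ (ib i))).
  move=> i; rewrite dE (integralB measurableT (iw _ (test1_bumpQ i))
    (integrableZl measurableT _ (ib i))).
  rewrite (integralZl measurableT (ib i)) wb IbE -EFinM -EFinB.
  by congr EFin; ring.
have uU : {ae mu, forall x, u x = C + P x}.
  by apply: aeS wC => x /eqP; rewrite subr_eq0 /w => /eqP <-; rewrite subrK.
have osc t s : t <= s ->
    (`|(C + P s) - (C + P t)|%:E <= \int[mu]_(x in `[t, s]) `|g x|%:E)%E.
  by move=> ts; rewrite opprD addrACA subrr add0r; exact: primitive_osc.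
apply: aeS uU => s us.
have uU : {ae mu, forall x, u x = C + P x}.
  by apply: aeS wC => x /eqP; rewrite subr_eq0 /w => /eqP <-; rewrite subrK.
by rewrite us; exact: (sup_le_of_oscillation mu_ mg u2 g2 uU osc s).
Qed.

End WeakSup.

(** * Weak derivatives along almost every line *)

Section Slices.
Context {R : realType} d (X : measurableType d)
  (m : {sigma_finite_measure set X -> \bar R}).
Notation mu := (@lebesgue_measure R).
Notation XR := (X * measurableTypeR R)%type.
Local Open Scope ereal_scope.

Lemma sq_integrable_slices (U : XR -> R) : measurable_fun setT U ->
  \int[m \x mu]_z (U z ^+ 2)%:E < +oo ->
  {ae m, forall q, \int[mu]_s (U (q, s) ^+ 2)%:E < +oo}.
Proof.
move=> mU U2.
have iU := integrable_sq mU U2.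
apply: aeS (ae_integrable1 iU) => q /integrableP[_].
by under eq_integral do rewrite gee0_abs ?lee_fin ?sqr_ge0//.
Qed.

Variables (I : countType) (b : I -> X -> R).
Hypotheses (tb : total_family m b) (b2 : forall i, \int[m]_x (b i x ^+ 2)%:E < +oo).
Variables (eta : R -> R) (psi : rat * rat * nat -> R -> R).
Hypotheses (teta : test1 eta) (tpsi : forall i, test1 (psi i))
  (dpsi : forall i, derive1 (psi i) =
     fun x => (bumpQ i x - (\int[mu]_t bumpQ i t) * eta x)%R).
Variables U G : XR -> R.
Hypotheses (mU : measurable_fun setT U) (mG : measurable_fun setT G)
  (U2 : \int[m \x mu]_z (U z ^+ 2)%:E < +oo)
  (G2 : \int[m \x mu]_z (G z ^+ 2)%:E < +oo).
Hypothesis UG : forall i j,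
  \int[m \x mu]_z (U z * (b i z.1 * derive1 (psi j) z.2))%:E =
  - \int[m \x mu]_z (G z * (b i z.1 * psi j z.2))%:E.

Let iprod (V : XR -> R) i f : measurable_fun setT V ->
  \int[m \x mu]_z (V z ^+ 2)%:E < +oo -> test1 f ->
  (m \x mu).-integrable setT (fun z => (V z * (b i z.1 * f z.2))%:E).
Proof.
move=> mV V2 tf; have [mb _ _] := tb.
have mbf : measurable_fun setT (fun z : XR => (b i z.1 * f z.2)%R).
  apply: measurable_funM.
    exact: measurableT_comp (mb i) measurable_fst.
  exact: measurableT_comp (test1_measurable tf) measurable_snd.
apply: integrable_mul_sq => //.
have bsq := integrable_sq (mb i) (b2 i).
have fsq := @integrable_sq _ _ R mu f (test1_measurable tf) (test1_sq tf).
have /integrableP[_] := integrable_prod_mul bsq fsq.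
apply: le_lt_trans; rewrite le_eqVlt; apply/orP; left; apply/eqP.
apply: eq_integral => z _ /=; rewrite -exprMn ger0_norm ?sqr_ge0//.
Qed.

(** For fixed [j], the defect of the identity on the line over [q] is a function [h] of [q] that
    [UG] makes orthogonal to the total family [b], hence null. Countability of [j] yields one
    exceptional set for all tests. *)
Lemma weak_slices : {ae m, forall q, forall j,
  \int[mu]_s (U (q, s) * derive1 (psi j) s)%:E =
  - \int[mu]_s (G (q, s) * psi j s)%:E}.
Proof.
apply: ae_forall_countable => j; have [mb nb bT] := tb.
have tp := tpsi j; have td := test1_derive1 tp.
pose k z := (U z * derive1 (psi j) z.2 + G z * psi j z.2)%R.
have mk : measurable_fun setT k.
  apply: measurable_funD; apply: measurable_funM => //.
    exact: measurableT_comp (test1_measurable td) measurable_snd.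
  exact: measurableT_comp (test1_measurable tp) measurable_snd.
have mEk : measurable_fun setT (fun z => (k z)%:E) by exact/measurable_EFinP.
pose h q := fine (\int[mu]_s (k (q, s))%:E).
have ik : {ae m, forall q, mu.-integrable setT (fun s => (U (q, s) * derive1 (psi j) s)%:E) /\
    mu.-integrable setT (fun s => (G (q, s) * psi j s)%:E)}.
  apply: aeS2 (sq_integrable_slices mU U2) (sq_integrable_slices mG G2) => q Uq Gq.
  split; apply: integrable_mul_sq => //; do ?[exact: test1_measurable|exact: test1_sq].
    exact: measurable_fun_pair2 mU.
  exact: measurable_fun_pair2 mG.
have ks q : (fun s => (k (q, s))%:E) =
   (fun s => (U (q, s) * derive1 (psi j) s)%:E + (G (q, s) * psi j s)%:E).
  by [].
have mh : measurable_fun setT h.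
  by apply: measurableT_comp => //; exact: measurable_fubini_integral mEk.
have h0 : {ae m, forall q, h q = 0%R}.
  have iKU i := iprod i mU U2 td; have iKG i := iprod i mG G2 tp.
  have iK i := integrableD measurableT (iKU i) (iKG i).
  have FE i : ae_eq m setT (fun q => \int[mu]_s
      ((U (q, s) * (b i q * derive1 (psi j) s))%:E + (G (q, s) * (b i q * psi j s))%:E))
      (fun q => (h q * b i q)%:E).
    apply: aeS ik => q [iUq iGq] _.
    have := integrableD measurableT iUq iGq; rewrite -ks => ikq.
    rewrite EFinM /h fineK; last exact: integrable_fin_num.
    rewrite -integralZr//; apply: eq_integral => s _.
    by rewrite -EFinD -EFinM; congr EFin; rewrite /k /=; ring.
  have mhb i : measurable_fun setT (fun q => (h q * b i q)%:E).
    by apply/measurable_EFinP; exact: measurable_funM.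
  apply: bT => // i.
    exact: ae_eq_integrable (mhb i) (FE i) (integrable_fubini_F (iK i)).
  have mF := measurable_int _ (integrable_fubini_F (iK i)).
  rewrite -(ae_eq_integral _ _ measurableT mF (mhb i) (FE i)).
  rewrite [LHS](integral12_prod_meas1 (iK i)) (integralD measurableT (iKU i) (iKG i)).
  rewrite UG addeC subee//; exact: integrable_fin_num (iKG i).
apply: aeS2 ik h0 => q [iUq iGq]; rewrite /h => hq.
have := integrableD measurableT iUq iGq; rewrite -ks => ikq.
have : \int[mu]_s (k (q, s))%:E = 0.
  by rewrite -(fineK (integrable_fin_num measurableT ikq)) hq.
rewrite ks integralD// => s0.
have Gfin := integrable_fin_num measurableT iGq.
by rewrite -[LHS](addeK _ Gfin) s0 add0e.
Qed.

Lemma slices_sup : {ae m, forall q, {ae mu, forall s, (U (q, s) ^+ 2)%:E <=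
   4%:E * \int[mu]_t (`|U (q, t)| * `|G (q, t)|)%:E}}.
Proof.
apply: aeS2 (sq_integrable_slices mU U2) (aeS2 (fun _ => @conj _ _)
  (sq_integrable_slices mG G2) weak_slices) => q Uq [Gq UGq].
exact: (@weak_derivative_sup _ _ _ teta tpsi dpsi (fun s => U (q, s))
  (fun s => G (q, s)) (measurable_fun_pair2 q mU) (measurable_fun_pair2 q mG) Uq Gq UGq).
Qed.

(** On almost every line [U^2] is at most 4 times the integral of [|U G|] over that line, while the
    weight has integral at most 2; integrating over the lines gives 8. *)
Lemma weighted_sq_le (w : XR -> \bar R) : measurable_fun setT w ->
  (forall z, 0 <= w z) -> (forall q, \int[mu]_s w (q, s) <= 2%:E) ->
  \int[m \x mu]_z ((U z ^+ 2)%:E * w z) <=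
    8%:E * \int[m \x mu]_z (`|U z| * `|G z|)%:E.
Proof.
move=> mw w0 w2.
have mUG : measurable_fun setT (fun z => (`|U z| * `|G z|)%:E).
  by apply/measurable_EFinP; apply: measurable_funM; exact: measurableT_comp.
have mUw : measurable_fun setT (fun z => (U z ^+ 2)%:E * w z).
  by apply: emeasurable_funM => //; apply/measurable_EFinP; exact: measurable_funX.
have UG0 z : 0 <= (`|U z| * `|G z|)%:E by rewrite lee_fin mulr_ge0.
have Uw0 z : 0 <= (U z ^+ 2)%:E * w z by rewrite mule_ge0// lee_fin sqr_ge0.
rewrite (fubini_tonelli1 _ mUw Uw0) (fubini_tonelli1 _ mUG UG0).
have mH := measurable_fun_fubini_tonelli_F (m2 := mu) _ mUG UG0.
have H0 q : 0 <= fubini_F mu (fun z => (`|U z| * `|G z|)%:E) q.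
  by apply: integral_ge0.
rewrite -ge0_integralZl//.
apply: ae_ge0_le_integral => //.
- by move=> q _; apply: integral_ge0.
- exact: (measurable_fun_fubini_tonelli_F _ mUw Uw0).
- by move=> q _; rewrite mule_ge0.
- exact: emeasurable_funM.
apply: aeS slices_sup => q Hq _; rewrite /fubini_F.
set H := \int[mu]_t _ in Hq *.
have Hq0 : 0 <= H := H0 q.
apply: (@le_trans _ _ (\int[mu]_s (4%:E * H * w (q, s)))).
  apply: ae_ge0_le_integral => //.
  - exact: measurable_fun_pair2 mUw.
  - by move=> s _; rewrite !mule_ge0.
  - apply: emeasurable_funM => //; exact: measurable_fun_pair2 mw.
  by apply: aeS Hq => s Us _; rewrite lee_wpmul2r.
rewrite ge0_integralZl//; last 2 first.
- exact: measurable_fun_pair2 mw.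
- by rewrite mule_ge0.
apply: (@le_trans _ _ (4%:E * H * 2%:E)).
  by rewrite lee_wpmul2l// mule_ge0.
rewrite muleAC -EFinM lee_wpmul2r// lee_fin.
by rewrite -natrM.
Qed.

End Slices.

(** * Uniqueness of weak derivatives *)

Section L2.
Context d (T : measurableType d) {R : realType} (m : {measure set T -> \bar R}).
Local Open Scope ereal_scope.

Lemma normr_powR2 (x : R) : (`|x| `^ 2 = x ^+ 2)%R.
Proof. by rewrite powR_mulrn// real_normK// num_real. Qed.

Lemma integral_Lnorm2 (f : T -> R) :
  'N[m]_2%:E[EFin \o f] ^+ 2 = \int[m]_x (f x ^+ 2)%:E.
Proof.
have pow2 (x : \bar R) : 0 <= x -> x ^+ 2 = x `^ 2.
  case: x => [r r0||//]; first by rewrite poweR_EFin powR_mulrn.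
  by rewrite poweRyr// expe2 mulyy.
rewrite pow2 ?Lnorm_ge0// poweR_Lnorm//.
by apply: eq_integral => x _; rewrite /= normr_powR2.
Qed.

Lemma Lfun2P (f : T -> R) : f \in Lfun m 2%:E <->
  measurable_fun setT f /\ \int[m]_x (f x ^+ 2)%:E < +oo.
Proof.
split=> [fL|[mf f2]].
  have /integrableP[_] := Lfun2_integrable_sqr fL.
  split; first by have := sub_Lfun_mfun fL; rewrite inE.
  by under [X in X < _]eq_integral do rewrite -(gee0_abs (x := (f _ ^+ 2)%:E)) ?lee_fin ?sqr_ge0//.
rewrite inE; apply/andP; split; rewrite inE//= /finite_norm unlock.
apply: poweR_lty; apply: le_lt_trans f2; rewrite le_eqVlt; apply/orP; left.
by apply/eqP; apply: eq_integral => x _; rewrite /= normr_powR2.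
Qed.

End L2.

Section Uniqueness.
Context {R : realType}.
Notation mu := (@lebesgue_measure R).
Notation R3 := (R * R * R)%type.
Local Open Scope ereal_scope.

Definition bumpQ2 (i : (rat * rat * nat) * (rat * rat * nat)) (q : R * R) : R :=
  (bumpQ i.1 q.1 * bumpQ i.2 q.2)%R.

(* The library's sigma-finite structure on products is not found by unification
   (its canonical projection is reserved for probabilities), hence this alias. *)
Definition lebesgue2 : set (measurableTypeR R * measurableTypeR R)%type -> \bar R :=
  mu \x mu.

HB.instance Definition _ := Measure.on lebesgue2.

Lemma lebesgue2_sigma_finite : sigma_finite setT lebesgue2.
Proof.
pose K (n : nat) := `[(- n%:R)%R, (n%:R)%R]%classic : set (measurableTypeR R).
have mK n : measurable (K n) by exact: measurable_itv.
exists (fun n => K n `*` K n); last first.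
  move=> n; split; first exact: measurableX.
  rewrite /lebesgue2 product_measure1E// /K /= lebesgue_measure_itv /=.
  by case: ifPn => _; rewrite ?mule0// -EFinB -EFinM ltry.
apply/seteqP; split => // -[x y] _.
have := archi_boundP (addr_ge0 (normr_ge0 (x : R)) (normr_ge0 (y : R))).
set n := Num.bound _ => xyn; exists n => //.
split; rewrite /K /= in_itv /= -ler_norml; apply: le_trans (ltW xyn).
  by rewrite lerDl.
by rewrite lerDr.
Qed.

HB.instance Definition _ :=
  Measure_isSigmaFinite.Build _ _ _ lebesgue2 lebesgue2_sigma_finite.

Lemma lebesgue3E : @lebesgue3 R = lebesgue2 \x mu :> (set _ -> \bar R).
Proof. by []. Qed.

Lemma total_bumpQ2 : total_family lebesgue2 bumpQ2.
Proof. exact: total_family_prod (@total_bumpQ R) (@total_bumpQ R). Qed.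

Lemma total_bumpQ3 : total_family (@lebesgue3 R)
  (fun i z => (bumpQ2 i.1 z.1 * bumpQ i.2 z.2)%R).
Proof. exact: total_family_prod total_bumpQ2 (@total_bumpQ R). Qed.

Lemma test1_prod_sq (f g : R -> R) : test1 f -> test1 g ->
  \int[lebesgue2]_q ((f q.1 * g q.2) ^+ 2)%:E < +oo.
Proof.
move=> tf tg.
have isq k (tk : test1 k) := @integrable_sq _ _ R mu k (test1_measurable tk) (test1_sq tk).
have /integrableP[_] := integrable_prod_mul (isq f tf) (isq g tg).
apply: le_lt_trans; rewrite le_eqVlt; apply/orP; left; apply/eqP.
by apply: eq_integral => z _ /=; rewrite -exprMn ger0_norm ?sqr_ge0.
Qed.

Lemma measurable_tens (f g h : R -> R) : test1 f -> test1 g -> test1 h ->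
  measurable_fun [set: measurableTypeR R * measurableTypeR R * measurableTypeR R]
    (tens f g h).
Proof.
move=> /test1_measurable mf /test1_measurable mg /test1_measurable mh.
apply: measurable_funM; last exact: measurableT_comp mh measurable_snd.
apply: measurable_funM.
  exact: measurableT_comp mf (measurableT_comp measurable_fst measurable_fst).
exact: measurableT_comp mg (measurableT_comp measurable_snd measurable_fst).
Qed.

Lemma tens_sq (f g h : R -> R) : test1 f -> test1 g -> test1 h ->
  \int[@lebesgue3 R]_z (tens f g h z ^+ 2)%:E < +oo.
Proof.
move=> tf tg th.
have mfg : measurable_fun setT
    (fun q : measurableTypeR R * measurableTypeR R => f q.1 * g q.2)%R.
  apply: measurable_funM.
    exact: measurableT_comp (test1_measurable tf) measurable_fst.
  exact: measurableT_comp (test1_measurable tg) measurable_snd.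
have i1 := @integrable_sq _ _ R lebesgue2 _ mfg (test1_prod_sq tf tg).
have i2 := @integrable_sq _ _ R mu _ (test1_measurable th) (test1_sq th).
have /integrableP[_] := integrable_prod_mul i1 i2.
apply: le_lt_trans; rewrite le_eqVlt; apply/orP; left; apply/eqP.
by apply: eq_integral => z _ /=; rewrite -exprMn ger0_norm ?sqr_ge0.
Qed.

(** Tensor products of bumps are test functions and form a total family, and both candidates give
    the same integral against each of them. *)
Lemma weak_partial_unique i (u g1 g2 : R3 -> R) :
  g1 \in Lfun (@lebesgue3 R) 2%:E -> g2 \in Lfun (@lebesgue3 R) 2%:E ->
  weak_partial_of i u g1 -> weak_partial_of i u g2 ->
  {ae @lebesgue3 R, forall x, g1 x = g2 x}.
Proof.
move=> /Lfun2P[mg1 g1sq] /Lfun2P[mg2 g2sq] w1 w2.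
have [_ _ T] := total_bumpQ3.
suff : {ae @lebesgue3 R, forall x, (g1 x - g2 x = 0)%R}.
  by apply: aeS => x /eqP; rewrite subr_eq0 => /eqP.
have tb (j : rat * rat * nat) := @test1_bumpQ R j.
have ig (g : R3 -> R) j : measurable_fun setT g ->
    \int[@lebesgue3 R]_x (g x ^+ 2)%:E < +oo ->
    (@lebesgue3 R).-integrable setT (fun x =>
      (g x * (bumpQ2 j.1 x.1 * bumpQ j.2 x.2))%:E).
  move=> mg gsq; apply: integrable_mul_sq => //.
    exact: (measurable_tens (tb j.1.1) (tb j.1.2) (tb j.2)).
  exact: (tens_sq (tb j.1.1) (tb j.1.2) (tb j.2)).
have E j : (fun x => ((g1 x - g2 x) * (bumpQ2 j.1 x.1 * bumpQ j.2 x.2))%:E) =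
  (fun x => (g1 x * (bumpQ2 j.1 x.1 * bumpQ j.2 x.2))%:E -
     (g2 x * (bumpQ2 j.1 x.1 * bumpQ j.2 x.2))%:E).
  by apply/funext => x; rewrite -EFinB mulrBl.
apply: T; first exact: measurable_funB.
  by move=> j; rewrite E; apply: (integrableB measurableT (ig _ _ mg1 g1sq) (ig _ _ mg2 g2sq)).
move=> j; rewrite E (integralB measurableT (ig _ _ mg1 g1sq) (ig _ _ mg2 g2sq)).
have tt := test_function_tens (tb j.1.1) (tb j.1.2) (tb j.2).
have := w1 _ tt; rewrite (w2 _ tt) => /oppe_inj ->.
by rewrite subee//; exact: (integrable_fin_num _ (ig _ j mg1 g1sq)).
Qed.

End Uniqueness.

(** * The Coulomb potential along coordinate lines *)

Section Kernel.
Context {R : realType}.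
Notation mu := (@lebesgue_measure R).
Notation R3 := (R * R * R)%type.
Notation mR3 := (measurableTypeR R * measurableTypeR R * measurableTypeR R)%type.
Local Open Scope ereal_scope.

(** The slice estimates integrate along the last factor of a product; this measure-preserving
    exchange makes them available along the second axis. *)
Definition swap23 (z : mR3) : mR3 := ((z.1.1, z.2), z.1.2).

Lemma measurable_swap23 : measurable_fun setT swap23.
Proof.
apply/measurable_fun_pairP; split => /=.
  apply/measurable_fun_pairP; split => /=; last exact: measurable_snd.
  exact: measurableT_comp measurable_fst measurable_fst.
exact: measurableT_comp measurable_snd measurable_fst.
Qed.

Lemma ge0_integral_lebesgue3 (f : mR3 -> \bar R) : measurable_fun setT f ->
  (forall z, 0 <= f z) ->
  \int[@lebesgue3 R]_z f z =
  \int[mu]_x1 \int[mu]_x2 \int[mu]_x3 f ((x1, x2), x3).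
Proof.
move=> mf f0.
rewrite lebesgue3E (@fubini_tonelli1 _ _ _ _ _ lebesgue2 mu f mf f0).
have mF := measurable_fun_fubini_tonelli_F (m2 := mu) f mf f0.
have F0 q : 0 <= fubini_F mu f q by apply: integral_ge0.
exact: (@fubini_tonelli1 _ _ _ _ _ mu mu _ mF F0).
Qed.

Lemma ge0_integral_swap23 (f : mR3 -> \bar R) : measurable_fun setT f ->
  (forall z, 0 <= f z) ->
  \int[@lebesgue3 R]_z f (swap23 z) = \int[@lebesgue3 R]_z f z.
Proof.
move=> mf f0.
rewrite (ge0_integral_lebesgue3 mf f0).
apply: (etrans (@ge0_integral_lebesgue3 (f \o swap23)
  (measurableT_comp mf measurable_swap23) (fun z => f0 (swap23 z)))).
apply: eq_integral => x1 _; rewrite /swap23 /=.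
have mg : measurable_fun setT
    (fun q : measurableTypeR R * measurableTypeR R => f ((x1, q.1), q.2)).
  apply: measurableT_comp mf _; apply/measurable_fun_pairP.
  split; last exact: measurable_snd.
  by apply/measurable_fun_pairP; split; [exact: measurable_cst|exact: measurable_fst].
by rewrite -(@fubini_tonelli _ _ _ _ _ mu mu (fun q => f ((x1, q.1), q.2))).
Qed.

Lemma integral_swap23 (f : mR3 -> \bar R) : measurable_fun setT f ->
  \int[@lebesgue3 R]_z f (swap23 z) = \int[@lebesgue3 R]_z f z.
Proof.
move=> mf; rewrite [LHS]integralE [RHS]integralE.
rewrite -(ge0_integral_swap23 (measurable_funepos mf))//.
rewrite -(ge0_integral_swap23 (measurable_funeneg mf))//.
by rewrite -[fun x => f (swap23 x)]/(f \o swap23) funepos_comp funeneg_comp.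
Qed.

Lemma measurable_enorm_sub (y : R3) :
  measurable_fun setT (fun x : mR3 => enorm ((x : R3) - y)%R).
Proof.
have m1 : measurable_fun setT (fun x : mR3 => x.1.1) :=
  measurableT_comp measurable_fst measurable_fst.
have m2 : measurable_fun setT (fun x : mR3 => x.1.2) :=
  measurableT_comp measurable_snd measurable_fst.
have m3 : measurable_fun setT (fun x : mR3 => x.2) := measurable_snd.
apply: (measurableT_comp (continuous_measurable_fun (@sqrt_continuous R))).
apply: measurable_funD; first apply: measurable_funD;
  by apply: measurable_funX; apply: measurable_funB.
Qed.

Lemma enorm_ge_coord (x : R3) :
  [/\ `|x.1.1| <= enorm x, `|x.1.2| <= enorm x & `|x.2| <= enorm x]%R.
Proof.
have h (a b : R) : (0 <= b)%R -> (`|a| <= Num.sqrt (a ^+ 2 + b))%R.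
  by move=> b0; rewrite -sqrtr_sqr ler_wsqrtr// lerDl.
rewrite /enorm; split.
- by rewrite -addrA; apply: h; rewrite addr_ge0 ?sqr_ge0.
- by rewrite (addrC (x.1.1 ^+ 2)%R) -addrA; apply: h; rewrite addr_ge0 ?sqr_ge0.
- by rewrite addrC; apply: h; rewrite addr_ge0 ?sqr_ge0.
Qed.

(** An interval of length [2 r] times a height at most [1 / r]. For [r = 0] the window is a single
    point, which is null whatever the value of [k] there. *)
Lemma integral_window_le2 (t r : R) (k : R -> R) : measurable_fun setT k ->
  (0 <= r)%R -> (forall s, 0 <= k s)%R -> (forall s, (0 < r)%R -> k s <= r^-1)%R ->
  \int[mu]_s ((`|s - t| <= r)%R%:R * k s)%:E <= 2%:E.
Proof.
move=> mk r0 k0 kr.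
have E : (fun s => ((`|s - t| <= r)%R%:R * k s)%:E) = (EFin \o k) \_ `[(t - r)%R, (t + r)%R].
  apply/funext => s; rewrite patchE mem_setE in_itv /= -ler_distlC distrC.
  by case: (_ <= _)%R; rewrite ?mul1r ?mul0r.
rewrite E -integral_mkcond.
move: r0; rewrite le_eqVlt => /orP[/eqP <-|r0].
  by rewrite subr0 addr0 set_itv1 integral_set1.
apply: (@le_trans _ _ (\int[mu]_(s in `[(t - r)%R, (t + r)%R]) (r^-1)%:E)).
  apply: ge0_le_integral => //.
  - by move=> s _; rewrite lee_fin.
  - by apply/measurable_EFinP; exact: measurable_funTS.
  - by move=> s _; rewrite lee_fin kr.
rewrite integral_cst//= lebesgue_measure_itv/= lte_fin.
rewrite ifT; last by rewrite ltrD2l gtrN.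
rewrite -EFinB -EFinM lee_fin opprB addrAC addrCA subrr addr0.
by rewrite -mulr2n -[(r *+ 2)%R]mulr_natl mulrCA mulVf ?mulr1// gt_eqF.
Qed.

Definition ax1 : 'I_3 := @Ordinal 3 1 isT.
Definition ax2 : 'I_3 := @Ordinal 3 2 isT.

(** The kernel cut off so that its integral along the third axis is bounded uniformly; [window2]
    exchanges the roles of the last two coordinates, and the two regions cover the space. *)
Definition window3 (y x : R3) : R :=
  ((`|x.2 - y.2| <= `|x.1.2 - y.1.2|)%R%:R * (enorm (x - y))^-1)%R.

Definition window2 (y x : R3) : R :=
  ((`|x.1.2 - y.1.2| <= `|x.2 - y.2|)%R%:R * (enorm (x - y))^-1)%R.

Lemma inv_enorm_le_windows y x : ((enorm (x - y)%R)^-1 <= window3 y x + window2 y x)%R.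
Proof.
rewrite -mulrDl ler_peMl ?invr_ge0 ?sqrtr_ge0//.
have [h|/ltW h] := leP `|x.2 - y.2|%R `|x.1.2 - y.1.2|%R.
  by rewrite -natrD ler1n.
by rewrite h -natrD ler1n addn1.
Qed.

Lemma measurable_inv_enorm_sub (y : R3) :
  measurable_fun setT (fun x : mR3 => (enorm ((x : R3) - y)%R)^-1)%R.
Proof.
rewrite (_ : (fun _ => _) = fun x : mR3 => (enorm ((x : R3) - y)%R `^ (-1))%R).
  exact: measurableT_comp (measurable_powR _) (measurable_enorm_sub y).
by apply/funext => x; rewrite powR_inv1 ?sqrtr_ge0.
Qed.

Lemma measurable_window (a b : mR3 -> R) y :
  measurable_fun setT a -> measurable_fun setT b ->
  measurable_fun setT (fun x : mR3 =>
    ((`|a x| <= `|b x|)%R%:R * (enorm ((x : R3) - y)%R)^-1)%R).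
Proof.
move=> ma mb; apply: measurable_funM; last exact: measurable_inv_enorm_sub.
rewrite (_ : (fun _ => _) = fun x : mR3 =>
    if (`|a x| <= `|b x|)%R then 1%R else 0%R); last first.
  by apply/funext => x; case: (_ <= _)%R.
by apply: measurable_fun_ifT => //; apply: measurable_fun_ler;
  exact: measurableT_comp.
Qed.

Lemma measurable_window3 y : measurable_fun setT (window3 y : mR3 -> R).
Proof.
have m2 : measurable_fun setT (fun x : mR3 => x.1.2) :=
  measurableT_comp measurable_snd measurable_fst.
have m3 : measurable_fun setT (fun x : mR3 => x.2) := measurable_snd.
exact: (measurable_window y (measurable_funB m3 (measurable_cst y.2))
  (measurable_funB m2 (measurable_cst y.1.2))).
Qed.

Lemma measurable_window2 y : measurable_fun setT (window2 y : mR3 -> R).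
Proof.
have m2 : measurable_fun setT (fun x : mR3 => x.1.2) :=
  measurableT_comp measurable_snd measurable_fst.
have m3 : measurable_fun setT (fun x : mR3 => x.2) := measurable_snd.
exact: (measurable_window y (measurable_funB m2 (measurable_cst y.1.2))
  (measurable_funB m3 (measurable_cst y.2))).
Qed.

Lemma window3_ge0 y x : (0 <= window3 y x)%R.
Proof. by rewrite mulr_ge0// invr_ge0 sqrtr_ge0. Qed.

Lemma window2_ge0 y x : (0 <= window2 y x)%R.
Proof. by rewrite mulr_ge0// invr_ge0 sqrtr_ge0. Qed.

Section Bound.
Variables u g : R3 -> R.
Hypotheses (mu_ : measurable_fun [set: mR3] u) (mg : measurable_fun [set: mR3] g)
  (u2 : \int[@lebesgue3 R]_x (u x ^+ 2)%:E < +oo)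
  (g2 : \int[@lebesgue3 R]_x (g x ^+ 2)%:E < +oo).

Lemma bumpQ2_sq i : \int[@lebesgue2 R]_q (bumpQ2 i q ^+ 2)%:E < +oo.
Proof. exact: test1_prod_sq (test1_bumpQ i.1) (test1_bumpQ i.2). Qed.

(** With the first two coordinates fixed, the half-width [r = |x_2 - y_2|] is constant, and
    [enorm (x - y) >= r] bounds the kernel by [1 / r]. The tests are two bumps times some [psi j],
    and the derivative along the third axis falls on [psi j] alone. *)
Lemma window3_bound y : weak_partial_of ax2 u g ->
  \int[@lebesgue3 R]_x ((u x ^+ 2)%:E * (window3 y x)%:E) <=
    8%:E * \int[@lebesgue3 R]_x (`|u x| * `|g x|)%:E.
Proof.
move=> wg; have [eta [psi [teta _ tpsi dpsi]]] := @mean_zero_primitives R.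
apply: (@weighted_sq_le R _ _ lebesgue2 _ _ total_bumpQ2 bumpQ2_sq _ _ teta
  tpsi dpsi u g) => //.
- move=> i j.
  have := wg _ (test_function_tens (test1_bumpQ i.1) (test1_bumpQ i.2) (tpsi j)).
  have := derive_tens ax2 (proj1 (test1_bumpQ (R := R) i.1))
    (proj1 (test1_bumpQ (R := R) i.2)) (proj1 (tpsi j)).
  move=> D; under eq_integral do rewrite (congr1 (@^~ _) D).
  by [].
- by apply/measurable_EFinP; exact: measurable_window3.
- by move=> z; rewrite lee_fin window3_ge0.
move=> q; apply: (@integral_window_le2 y.2 `|q.2 - y.1.2|%R
    (fun s : R => (enorm (((q : R * R), s) - y)%R)^-1)%R
    (measurable_fun_pair2 q (measurable_inv_enorm_sub y)) (normr_ge0 _)).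
  by move=> s; rewrite invr_ge0 sqrtr_ge0.
move=> s r0; have [_ h _] := enorm_ge_coord (((q : R * R), s) - y)%R.
by rewrite lef_pV2 ?posrE //; exact: lt_le_trans r0 h.
Qed.

Lemma window2_bound y : weak_partial_of ax1 u g ->
  \int[@lebesgue3 R]_x ((u x ^+ 2)%:E * (window2 y x)%:E) <=
    8%:E * \int[@lebesgue3 R]_x (`|u x| * `|g x|)%:E.
Proof.
move=> wg; have [eta [psi [teta _ tpsi dpsi]]] := @mean_zero_primitives R.
have msw (f : mR3 -> R) : measurable_fun setT f ->
    measurable_fun setT (fun z => f (swap23 z)).
  by move=> mf; exact: measurableT_comp mf measurable_swap23.
have mE (f : mR3 -> R) : measurable_fun setT f -> measurable_fun setT (EFin \o f).
  by move=> mf; exact/measurable_EFinP.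
have sq_sw (f : mR3 -> R) : measurable_fun setT f ->
   \int[@lebesgue3 R]_x (f (swap23 x) ^+ 2)%:E = \int[@lebesgue3 R]_x (f x ^+ 2)%:E.
  move=> mf; apply: (integral_swap23 (f := fun x => (f x ^+ 2)%:E)).
  by apply: mE; exact: measurable_funX.
rewrite -(integral_swap23 (f := fun x => (u x ^+ 2)%:E * (window2 y x)%:E)); last first.
  by apply: emeasurable_funM; apply: mE; [exact: measurable_funX|exact: measurable_window2].
rewrite -(integral_swap23 (f := fun x => (`|u x| * `|g x|)%:E)); last first.
  by apply: mE; apply: measurable_funM; exact: measurableT_comp.
apply: (@weighted_sq_le R _ _ lebesgue2 _ _ total_bumpQ2 bumpQ2_sq _ _ teta
  tpsi dpsi (fun z => u (swap23 z)) (fun z => g (swap23 z)) _ _ _ _ _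
  (fun z => (window2 y (swap23 z))%:E)).
- exact: msw.
- exact: msw.
- by rewrite -lebesgue3E sq_sw.
- by rewrite -lebesgue3E sq_sw.
- move=> i j; have ti := test1_bumpQ (R := R) i.1; have ti' := test1_bumpQ (R := R) i.2.
  have := wg _ (test_function_tens ti (tpsi j) ti').
  have := derive_tens ax1 (proj1 ti) (proj1 (tpsi j)) (proj1 ti').
  move=> D; under eq_integral do rewrite (congr1 (@^~ _) D).
  rewrite -(integral_swap23 (f := fun x => (u x * tens (bumpQ i.1) (derive1 (psi j)) (bumpQ i.2) x)%:E)); last first.
    apply: mE; apply: measurable_funM => //; apply: measurable_tens => //.
    exact: test1_derive1.
  rewrite -(integral_swap23 (f := fun x => (g x * tens (bumpQ i.1) (psi j) (bumpQ i.2) x)%:E)); last first.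
    by apply: mE; apply: measurable_funM => //; exact: measurable_tens.
  move=> H; rewrite -lebesgue3E.
  rewrite (_ : (fun z => (g (swap23 z) * (bumpQ2 i z.1 * psi j z.2))%:E) =
    (fun z => (g (swap23 z) * tens (bumpQ i.1) (psi j) (bumpQ i.2) (swap23 z))%:E)).
    rewrite -H; apply: eq_integral => z _; congr EFin.
    by rewrite /tens /bumpQ2 /swap23 /=; ring.
  by apply/funext => z; congr EFin; rewrite /tens /bumpQ2 /swap23 /=; ring.
- by apply: mE; apply: msw; exact: measurable_window2.
- by move=> z; rewrite lee_fin window2_ge0.
move=> q; apply: (@integral_window_le2 y.1.2 `|q.2 - y.2|%R
    (fun s : R => (enorm (((q.1, s), q.2) - y)%R)^-1)%R
    (measurable_fun_pair2 q (msw _ (measurable_inv_enorm_sub y))) (normr_ge0 _)).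
  by move=> s; rewrite invr_ge0 sqrtr_ge0.
move=> s r0; have [_ _ h] := enorm_ge_coord (((q.1, s), q.2) - y)%R.
by rewrite lef_pV2 ?posrE //; exact: lt_le_trans r0 h.
Qed.

End Bound.
End Kernel.

(** * Dilations *)

Section Dilation.
Context {R : realType}.
Notation mu := (@lebesgue_measure R).
Notation R3 := (R * R * R)%type.
Notation mR3 := (measurableTypeR R * measurableTypeR R * measurableTypeR R)%type.
Local Open Scope ereal_scope.

Lemma muleB_pos (r : R) (x y : \bar R) : (0 < r)%R ->
  r%:E * (x - y) = r%:E * x - r%:E * y.
Proof.
move=> r0; case: x y => [x| |] [y| |] //=;
  rewrite ?(gt0_muley, gt0_muleNy) ?lte_fin//=.
by rewrite -EFinB -!EFinM -EFinB mulrBr.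
Qed.

(** Measurability suffices because a positive factor commutes with extended subtraction, including
    the value assigned to [+oo - +oo]. *)
Lemma integral_scale_pos d (T : measurableType d) (m : {measure set T -> \bar R})
    (r : R) (f : T -> \bar R) : (0 < r)%R -> measurable_fun setT f ->
  \int[m]_x (r%:E * f x) = r%:E * \int[m]_x f x.
Proof.
move=> r0 mf; rewrite integralE [in RHS]integralE muleB_pos//.
rewrite ge0_funeposM ?ltW// ge0_funenegM ?ltW//.
rewrite !ge0_integralZl_EFin// ?ltW//.
- exact: measurable_funeneg.
- exact: measurable_funepos.
Qed.

(** The pushforward of Lebesgue measure under [x |-> a x], multiplied by [a], agrees with Lebesgue
    measure on half-open intervals and hence everywhere. *)
Lemma ge0_integral_dilation (a : R) (f : R -> \bar R) : (0 < a)%R ->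
  measurable_fun setT f -> (forall x, 0 <= f x) ->
  \int[mu]_x f (a * x)%R = (a^-1)%:E * \int[mu]_x f x.
Proof.
move=> a0 mf f0.
pose phi : measurableTypeR R -> measurableTypeR R := fun x => (a * x)%R.
have mphi : measurable_fun setT phi by exact: mulrl_measurable.
pose nu := mscale (NngNum (ltW a0)) (pushforward mu phi).
have E : \int[mu]_x f x = a%:E * \int[mu]_x f (a * x)%R.
  rewrite -(@ge0_integral_pushforward _ _ _ _ _ phi mphi mu setT f)//.
  rewrite -(ge0_integral_mscale (pushforward mu phi) measurableT (NngNum (ltW a0)))//.
  apply: eq_measure_integral => A mA _.
  apply: lebesgue_measure_unique => // _ [[x y]] _ <-.
  transitivity (a%:E * mu [set` `](x / a)%R, (y / a)%R]]); last first.
    rewrite /mscale /pushforward /=; congr (_ * mu _).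
    apply/funext => t; apply/propext; rewrite /= !in_itv /= /phi.
    by rewrite ltr_pdivrMr// ler_pdivlMr// mulrC.
  rewrite !lebesgue_measure_itv /= !lte_fin ltr_pM2r ?invr_gt0//.
  case: ifPn => _; last by rewrite mule0.
  rewrite -!EFinB -EFinM; congr EFin; rewrite mulrBr ![(a * _)%R]mulrC.
  by rewrite !divfK ?gt_eqF.
by rewrite E muleA -EFinM mulVf ?mul1e// gt_eqF.
Qed.

Definition dil (c : R) (x : R3) : R3 := ((c * x.1.1, c * x.1.2), c * x.2)%R.

Lemma measurable_dil c : measurable_fun setT (dil c : mR3 -> mR3).
Proof.
have mc : measurable_fun setT (fun x : measurableTypeR R => (c * x)%R : measurableTypeR R).
  exact: mulrl_measurable.
apply/measurable_fun_pairP; split.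
  apply/measurable_fun_pairP; split.
    exact: measurableT_comp mc (measurableT_comp measurable_fst measurable_fst).
  exact: measurableT_comp mc (measurableT_comp measurable_snd measurable_fst).
exact: measurableT_comp mc measurable_snd.
Qed.

Lemma ge0_integral_dil (c : R) (f : mR3 -> \bar R) : (0 < c)%R ->
  measurable_fun setT f -> (forall x, 0 <= f x) ->
  \int[@lebesgue3 R]_x f (dil c x) = (c ^- 3)%:E * \int[@lebesgue3 R]_x f x.
Proof.
move=> c0 mf f0; have ci : (0 <= c^-1)%R by rewrite invr_ge0 ltW.
apply: (etrans (@ge0_integral_lebesgue3 R (f \o dil c)
  (measurableT_comp mf (measurable_dil c)) (fun z => f0 (dil c z)))).
rewrite (ge0_integral_lebesgue3 mf f0) /=.
pose F q := \int[mu]_z f (q, z); pose F1 x := \int[mu]_y F (x, y).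
have F0 q : 0 <= F q by exact: integral_ge0.
have F10 x : 0 <= F1 x by exact: integral_ge0.
have mF : measurable_fun setT F := measurable_fun_fubini_tonelli_F f mf f0.
have mF1 : measurable_fun setT F1 := measurable_fun_fubini_tonelli_F F mF F0.
transitivity (\int[mu]_x (((c^-1)%:E * (c^-1)%:E) * F1 (c * x)%R)).
  apply: eq_integral => x _.
  transitivity (\int[mu]_y ((c^-1)%:E * F ((c * x)%R, (c * y)%R))).
    apply: eq_integral => y _.
    exact: (ge0_integral_dilation (f := fun z => f (((c * x)%R, (c * y)%R), z)) c0
      (measurable_fun_pair2 ((c * x)%R, (c * y)%R) mf) (fun _ => f0 _)).
  have mFx := measurable_fun_pair2 (c * x)%R mF.
  have mFcx : measurable_fun setT (fun y : R => F ((c * x)%R, (c * y)%R)).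
    by apply: (measurableT_comp mFx); exact: mulrl_measurable.
  rewrite (@ge0_integralZl_EFin _ _ _ mu setT measurableT _ (fun y _ => F0 _) mFcx _ ci).
  by rewrite (ge0_integral_dilation (f := fun y => F ((c * x)%R, y)) c0 mFx)// muleA.
have mF1c : measurable_fun setT (fun x : R => F1 (c * x)%R).
  by apply: (measurableT_comp mF1); exact: mulrl_measurable.
rewrite -EFinM (@ge0_integralZl_EFin _ _ _ mu setT measurableT _ (fun y _ => F10 _)
  mF1c _ (mulr_ge0 ci ci)).
rewrite (ge0_integral_dilation c0 mF1)// muleA -EFinM; congr (_%:E * _).
by rewrite !exprS expr0 mulr1 !invfM mulrA.
Qed.

Lemma integral_dil (c : R) (f : mR3 -> \bar R) : (0 < c)%R ->
  measurable_fun setT f ->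
  \int[@lebesgue3 R]_x f (dil c x) = (c ^- 3)%:E * \int[@lebesgue3 R]_x f x.
Proof.
move=> c0 mf; rewrite integralE [in RHS]integralE muleB_pos ?invr_gt0 ?exprn_gt0//.
rewrite -(ge0_integral_dil c0 (measurable_funepos mf))//.
rewrite -(ge0_integral_dil c0 (measurable_funeneg mf))//.
by rewrite -[fun x => f (dil c x)]/(f \o dil c) funepos_comp funeneg_comp.
Qed.

End Dilation.

(** * Test functions and weak derivatives under dilation *)

Section TestDilation.
Context {R : realType}.
Notation R3 := (R * R * R)%type.
Notation mR3 := (measurableTypeR R * measurableTypeR R * measurableTypeR R)%type.

Definition grid (n : nat) (t : R) : R := (Num.floor (n.+1%:R * t))%:~R / n.+1%:R.

Lemma grid_dist n t : `|t - grid n t| <= n.+1%:R^-1.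
Proof.
rewrite /grid.
have n0 : 0 < n.+1%:R :> R by [].
have /andP[h1 h2] := floor_itv (n.+1%:R * t); rewrite intrD1 in h2.
set z := (Num.floor _)%:~R in h1 h2 *.
have -> : t - z / n.+1%:R = (n.+1%:R * t - z) / n.+1%:R by field; rewrite gt_eqF.
rewrite normrM ger0_norm ?subr_ge0// gtr0_norm ?invr_gt0//.
by rewrite ler_piMl ?invr_ge0// lerBlDl addrC ltW // addrC.
Qed.

Lemma cvg_grid t : grid n t @[n --> \oo] --> t.
Proof.
apply/cvgrPdist_le => e e0; near=> n.
apply: le_trans (grid_dist n t) _; apply: ltW; near: n.
exact: near_infty_natSinv_lt (PosNum e0).
Unshelve. all: end_near. Qed.

(* [f] is the pointwise limit of its samples on the grids of mesh 1/(n+1). *)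
Lemma continuous_measurable3 (f : R3 -> R) : continuous f ->
  measurable_fun setT (f : mR3 -> R).
Proof.
move=> cf.
pose r n (x : mR3) : mR3 := ((grid n x.1.1, grid n x.1.2), grid n x.2).
apply: (@measurable_fun_cvg _ mR3 R setT (fun n => f \o r n)).
  move=> n _ B mB; rewrite setTI.
  pose E (k : int * int * int) : set mR3 :=
    ([set t | Num.floor (n.+1%:R * t) = k.1.1] `*`
     [set t | Num.floor (n.+1%:R * t) = k.1.2]) `*`
     [set t | Num.floor (n.+1%:R * t) = k.2].
  pose v (k : int * int * int) : R3 :=
    ((k.1.1%:~R / n.+1%:R, k.1.2%:~R / n.+1%:R), k.2%:~R / n.+1%:R).
  (* The sampled function is constant on each grid cell, so the preimage is a countable union of
     cells, which are products of half-open intervals. *)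
  have -> : (f \o r n) @^-1` B = \bigcup_(k : int * int * int)
       (if f (v k) \in B then E k else set0).
    apply/seteqP; split=> [x Bx|x [k _]].
      exists ((Num.floor (n.+1%:R * x.1.1), Num.floor (n.+1%:R * x.1.2)),
        Num.floor (n.+1%:R * x.2)) => //.
      by rewrite ifT ?inE.
    case: ifPn => // /set_mem Bk [[/= k1 k2] k3].
    by rewrite /r /grid /= k1 k2 k3.
  apply: countable_bigcupT_measurable => // k.
  case: ifPn => // _.
  have mfl (z : int) : measurable ([set t | Num.floor (n.+1%:R * t) = z] : set (measurableTypeR R)).
    rewrite (_ : [set _ | _] = `[z%:~R / n.+1%:R, (z + 1)%:~R / n.+1%:R[%classic) //.
    apply/seteqP; split=> t /=; rewrite in_itv /= ler_pdivrMr// ltr_pdivlMr//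
      ![t * _]mulrC.
      by move=> <-; exact: floor_itv.
    by move/floor_def.
  by apply: measurableX => //; exact: measurableX.
move=> [[x1 x2] x3] _.
have H : (((grid n x1, grid n x2), grid n x3) : R3) @[n --> \oo] --> (((x1, x2), x3) : R3).
  exact: (cvg_pair (cvg_pair (@cvg_grid x1) (@cvg_grid x2)) (@cvg_grid x3)).
exact: (cvg_comp _ _ H (cf _)).
Qed.

Lemma is_derive_along {V : normedModType R} (f : V -> R) y v (D : R) :
  is_derive y v f D -> is_derive (0 : R) 1 (fun t => f (t *: v + y)) D.
Proof.
move=> [df <-].
have E : (fun h : R => h^-1 *: (f ((h *: (1 : R) + 0 : R) *: v + y) - f ((0 : R) *: v + y))) =
         (fun h : R => h^-1 *: (f (h *: v + y) - f y)).
  by apply/funext => h; rewrite addr0 scale0r add0r /GRing.scale/= mulr1.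
by split; [rewrite /derivable E|rewrite /derive E].
Qed.

(** Only a directional derivative is assumed, so the chain rule is applied on the line through
    [dil c x] in the direction [e], where the dilation acts as [t |-> c t]. *)
Lemma is_derive_dil (f : R3 -> R) c d x e (D : R) :
  is_derive (dil c x : R3) e f D ->
  is_derive (x : R3) e (fun x => d * f (dil c x)) (d * c * D).
Proof.
move=> /is_derive_along; set K := (fun t => _) => dK.
have dk : is_derive (0 : R) 1 (fun t : R => d * K (c * t)) (d * c * D).
  have dc : is_derive (0 : R) 1 (fun t : R => c * t) c.
    by apply: is_derive_eq; rewrite /GRing.scale/= mulr1.
  have dK' : is_derive (c * 0) 1 K D by rewrite mulr0.
  have := @is_derive1_comp _ K (fun t => c * t) 0 _ _ dK' dc => dKc.
  by apply: is_derive_eq; rewrite /GRing.scale/=; ring.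
apply: (is_derive_line _ dk) => h; rewrite /K addr0; congr (d * f _).
rewrite /dil; case: x {K dK dk} => [[x1 x2] x3]; case: e => [[e1 e2] e3] /=.
have H (a b : R) : c * (h * a + b) = c * h * a + c * b by ring.
by congr (_, _, _); exact: H.
Qed.

Lemma continuous_dil c : continuous (dil c : R3 -> R3).
Proof. exact: scaler_continuous. Qed.

(** The amplitude [d] is arbitrary because each differentiation multiplies it by [c]. *)
Lemma Ck_dil k (f : R3 -> R) c d : Ck k f -> Ck k (fun x => d * f (dil c x)).
Proof.
have C0 (h : R3 -> R) r : continuous h -> continuous (fun x => r * h (dil c x)).
  move=> ch x; apply: cvgM; first exact: cvg_cst.
  exact: (continuous_comp (@continuous_dil c x) (ch (dil c x))).
elim: k f d => [|k IH] f d; first exact: C0.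
move=> [cf Df]; split; first exact: C0.
move=> i; have [dfi Cfi] := Df i.
have dd x := @is_derive_dil f c d x _ _ (derivableP (dfi (dil c x))).
split=> [x|]; first by case: (dd x).
rewrite (_ : (fun x => _) = (fun x => (d * c) * 'D_(basis3 R i) f (dil c x))).
  exact: (IH (fun x => 'D_(basis3 R i) f x) (d * c) Cfi).
by apply/funext => x; have [] := dd x.
Qed.

Lemma derive_dil (f : R3 -> R) c i : test_function f ->
  forall x, 'D_(basis3 R i) (fun x => f (dil c x)) x = c * 'D_(basis3 R i) f (dil c x).
Proof.
move=> [/(_ 1%N) [_ /(_ i) [df _]] _] x.
have [_] := @is_derive_dil f c 1 x _ _ (derivableP (df (dil c x))).
rewrite mul1r => <-; congr ('D__ _ _).
by apply/funext => z; rewrite mul1r.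
Qed.

Lemma dilK c : c != 0 -> cancel (dil c : R3 -> R3) (dil c^-1).
Proof.
by move=> c0 [[x1 x2] x3]; rewrite /dil /= !mulrA mulVf// !mul1r.
Qed.

Lemma test_function_dil (f : R3 -> R) c : c != 0 -> test_function f ->
  test_function (fun x => f (dil c x)).
Proof.
move=> c0 [Cf Kf]; split=> [k|].
  rewrite (_ : (fun x => _) = (fun x => 1 * f (dil c x))); first exact: Ck_dil.
  by apply/funext => x; rewrite mul1r.
set K := closure _ in Kf.
have cK : compact (dil c^-1 @` K).
  apply: continuous_compact Kf; apply: continuous_subspaceT; exact: continuous_dil.
have clK : closed (dil c^-1 @` K) by apply: compact_closed => //; exact: norm_hausdorff.
apply: (subclosed_compact _ cK); first exact: closed_closure.
rewrite (proj1 (closure_id _) clK); apply: closureS => x /= fx.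
by exists (dil c x); [exact: subset_closure|exact: dilK].
Qed.

(* For the scaled function the weak derivative picks up the chain-rule factor. *)
Lemma weak_partial_dil i (u g : R3 -> R) (r c : R) : 0 < r -> 0 < c ->
  measurable_fun setT (u : mR3 -> R) -> measurable_fun setT (g : mR3 -> R) ->
  weak_partial_of i u g ->
  weak_partial_of i (fun x => r * u (dil c x)) (fun x => r * c * g (dil c x)).
Proof.
move=> r0 c0 mu mg wg phi tphi.
have cn0 : c != 0 by rewrite gt_eqF.
have cVn0 : c^-1 != 0 by rewrite invr_eq0.
pose psi (x : R3) := phi (dil c^-1 x).
have tpsi : test_function psi by exact: test_function_dil.
have psiE x : phi x = psi (dil c x) by rewrite /psi dilK.
have dpsiE x : 'D_(basis3 R i) phi x = c * 'D_(basis3 R i) psi (dil c x).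
  by rewrite (derive_dil _ _ tphi) dilK// mulrA mulfV// mul1r.
have mpsi : measurable_fun setT (psi : mR3 -> R).
  by apply: continuous_measurable3; have [/(_ 0%N)] := tpsi.
have mdpsi : measurable_fun setT ((fun x => 'D_(basis3 R i) psi x) : mR3 -> R).
  by apply: continuous_measurable3; have [/(_ 1%N)[_ /(_ i)[]]] := tpsi.
have rc0 : 0 < r * c by rewrite mulr_gt0.
have scaled (v w : R3 -> R) : measurable_fun setT (v : mR3 -> R) ->
    measurable_fun setT (w : mR3 -> R) ->
    (\int[@lebesgue3 R]_x (r * c * (v (dil c x) * w (dil c x)))%:E =
     (c ^- 3)%:E * ((r * c)%:E * \int[@lebesgue3 R]_x (v x * w x)%:E))%E.
  move=> mv mw.
  have mvw : measurable_fun setT (fun x : mR3 => (v x * w x)%:E).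
    by apply/measurable_EFinP; exact: measurable_funM.
  rewrite -(integral_scale_pos _ rc0 mvw) -(integral_dil c0); last exact: emeasurable_funM.
  by apply: eq_integral => x _; rewrite EFinM.
transitivity (\int[@lebesgue3 R]_x
    (r * c * (u (dil c x) * 'D_(basis3 R i) psi (dil c x)))%:E)%E.
  by apply: eq_integral => x _; congr EFin; rewrite dpsiE; ring.
rewrite (scaled u (fun x => 'D_(basis3 R i) psi x)) // (wg _ tpsi) !muleN.
rewrite -(scaled g psi)//; congr (- _)%E.
by apply: eq_integral => x _; congr EFin; rewrite psiE; ring.
Qed.

End TestDilation.

(** * Energy estimates *)

Section Energy.
Context {R : realType}.
Notation R3 := (R * R * R)%type.
Notation mR3 := (measurableTypeR R * measurableTypeR R * measurableTypeR R)%type.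
Notation L3 := (@lebesgue3 R).
Local Open Scope ereal_scope.

(** Simple functions below [f] are below [g], so the suprema compare with no measurability of either
    side. In [coulomb_le] this is applied to an integrand containing the potential. *)
Lemma ge0_le_integral_pointwise d (T : measurableType d) (m : {measure set T -> \bar R})
    (f g : T -> \bar R) : (forall x, 0 <= f x) -> (forall x, f x <= g x) ->
  \int[m]_x f x <= \int[m]_x g x.
Proof.
move=> f0 fg; rewrite !ge0_integralTE//; last by move=> x; exact: le_trans (fg x).
apply: ereal_sup_le => _ [h hf <-]; exists h => // x.
exact: le_trans (hf x) (fg x).
Qed.

Lemma weak_partialP i (u : R3 -> R) : H1 u ->
  [/\ measurable_fun setT (weak_partial i u : mR3 -> R),
      \int[L3]_x (weak_partial i u x ^+ 2)%:E < +oo &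
      weak_partial_of i u (weak_partial i u)].
Proof.
move=> [_ /(_ i)[g gL gw]].
have : exists g, [set g | g \in Lfun L3 2%:E /\ weak_partial_of i u g] g.
  by exists g.
by move/(xgetPex (fun=> 0%R)) => [/Lfun2P[? ?] ?]; split.
Qed.

Lemma H1_sq (u : R3 -> R) : H1 u ->
  measurable_fun setT (u : mR3 -> R) /\ \int[L3]_x (u x ^+ 2)%:E < +oo.
Proof. by move=> [/Lfun2P]. Qed.

Lemma grad_dotE (u v : R3 -> R) x : grad_dot u v x =
  (weak_partial ord0 u x * weak_partial ord0 v x +
   (weak_partial ax1 u x * weak_partial ax1 v x +
    weak_partial ax2 u x * weak_partial ax2 v x))%R.
Proof.
have e2 : lift (ord0 : 'I_3) (lift (ord0 : 'I_2) (ord0 : 'I_1)) = ax2.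
  exact/val_inj.
rewrite /grad_dot big_ord_recl; congr (_ + _)%R.
rewrite big_ord_recl; congr (_ + _)%R; rewrite big_ord_recl big_ord0 GRing.addr0 e2.
reflexivity.
Qed.

Lemma integral_grad_dot (u : R3 -> R) : H1 u ->
  \int[L3]_x (grad_dot u u x)%:E = \int[L3]_x (weak_partial ord0 u x ^+ 2)%:E +
   (\int[L3]_x (weak_partial ax1 u x ^+ 2)%:E + \int[L3]_x (weak_partial ax2 u x ^+ 2)%:E).
Proof.
move=> Hu.
have msq i : measurable_fun setT (fun x : mR3 => (weak_partial i u x ^+ 2)%:E).
  have [mg _ _] := weak_partialP i Hu.
  by apply/measurable_EFinP; exact: measurable_funX.
have sq0 i x : 0 <= (weak_partial i u x ^+ 2)%:E by rewrite lee_fin sqr_ge0.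
have D12 := @ge0_integralD _ _ _ L3 setT measurableT _ _
  (fun x _ => sq0 ax1 x) (msq ax1) (fun x _ => sq0 ax2 x) (msq ax2).
have D0 := @ge0_integralD _ _ _ L3 setT measurableT _ _
  (fun x _ => sq0 ord0 x) (msq ord0) (fun x _ => adde_ge0 (sq0 ax1 x) (sq0 ax2 x))
  (emeasurable_funD (msq ax1) (msq ax2)).
refine (etrans _ (etrans D0 (congr1 (fun t => _ + t) D12))).
apply: eq_integral => x _; rewrite grad_dotE -!EFinD.
by congr (EFin (_ + (_ + _))%R); rewrite expr2.
Qed.

Lemma enormN (x y : R3) : enorm (x - y)%R = enorm (y - x)%R.
Proof.
rewrite /enorm /=; congr Num.sqrt.
by congr (_ + _ + _)%R; rewrite -[RHS]sqrrN opprB.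
Qed.

Definition coulomb (u : R3 -> R) : \bar R :=
  \int[L3]_x \int[L3]_y (`|u x| ^+ 2 * `|u y| ^+ 2 / enorm (x - y)%R)%:E.

Lemma mixed_le (f g : R3 -> R) (d : R) : (0 < d)%R ->
  measurable_fun setT (f : mR3 -> R) -> measurable_fun setT (g : mR3 -> R) ->
  \int[L3]_x (`|f x| * `|g x|)%:E <=
   (d / 2)%:E * \int[L3]_x (g x ^+ 2)%:E + ((2 * d)^-1)%:E * \int[L3]_x (f x ^+ 2)%:E.
Proof.
move=> d0 mf mg.
have h1 : (0 <= d / 2)%R by rewrite divr_ge0// ltW.
have h2 : (0 <= (2 * d)^-1)%R by rewrite invr_ge0 mulr_ge0// ltW.
have msq (k : R3 -> R) : measurable_fun setT (k : mR3 -> R) ->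
    measurable_fun setT (fun x : mR3 => (k x ^+ 2)%:E).
  by move=> mk; apply/measurable_EFinP; exact: measurable_funX.
have sq0 (k : R3 -> R) x : 0 <= (k x ^+ 2)%:E by rewrite lee_fin sqr_ge0.
have Z (k : R3 -> R) r (mk : measurable_fun setT (k : mR3 -> R)) (r0 : (0 <= r)%R) :=
  @ge0_integralZl_EFin _ _ _ L3 setT measurableT _ (fun x _ => sq0 k x) (msq k mk) r r0.
have scale0 (k : R3 -> R) r x : (0 <= r)%R -> 0 <= r%:E * (k x ^+ 2)%:E.
  by move=> r0; exact: mule_ge0.
have mscale (k : R3 -> R) r : measurable_fun setT (k : mR3 -> R) ->
    measurable_fun setT (fun x : mR3 => r%:E * (k x ^+ 2)%:E).
  by move=> mk; apply: measurable_funeM; exact: msq.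
have D := @ge0_integralD _ _ _ L3 setT measurableT _ _
  (fun x _ => scale0 g _ x h1) (mscale g (d / 2)%R mg)
  (fun x _ => scale0 f _ x h2) (mscale f ((2 * d)^-1)%R mf).
rewrite (_ : _ + _ = \int[L3]_x ((d / 2)%:E * (g x ^+ 2)%:E +
    ((2 * d)^-1)%:E * (f x ^+ 2)%:E)); last first.
  by refine (etrans _ (esym D)); congr (_ + _); exact/esym/Z.
apply: ge0_le_integral_pointwise => x; first by rewrite lee_fin mulr_ge0.
rewrite -!EFinM -EFinD lee_fin.
rewrite -(real_normK (num_real (f x))) -(real_normK (num_real (g x))).
set A := `|f x|%R; set B := `|g x|%R.
rewrite -subr_ge0 (_ : (_ - _)%R = ((2 * d)^-1 * (d * B - A) ^+ 2)%R).
  by rewrite mulr_ge0// sqr_ge0.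
by field; rewrite gt_eqF.
Qed.

End Energy.

(** * The Coulomb energy bounded by gradient and mass *)

Section Coulomb.
Context {R : realType}.
Notation R3 := (R * R * R)%type.
Notation mR3 := (measurableTypeR R * measurableTypeR R * measurableTypeR R)%type.
Notation L3 := (@lebesgue3 R).
Local Open Scope ereal_scope.

Definition potential (u : R3 -> R) (x : R3) : \bar R :=
  \int[L3]_y (u y ^+ 2 / enorm (x - y)%R)%:E.

Lemma measurable_potential_integrand (u : R3 -> R) x :
  measurable_fun setT (u : mR3 -> R) ->
  measurable_fun setT (fun y : mR3 => (u y ^+ 2 / enorm (x - y)%R)%:E).
Proof.
move=> mu; apply/measurable_EFinP.
rewrite (_ : (fun _ => _) = fun y : mR3 => (u y ^+ 2 * (enorm ((y : R3) - x)%R)^-1)%R).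
  by apply: measurable_funM; [exact: measurable_funX|exact: measurable_inv_enorm_sub].
by apply/funext => y; rewrite (enormN x y).
Qed.

Lemma potential_integrand_ge0 (u : R3 -> R) x y : 0 <= (u y ^+ 2 / enorm (x - y)%R)%:E.
Proof. by rewrite lee_fin divr_ge0 ?sqr_ge0 ?sqrtr_ge0. Qed.

Lemma coulombE (u : R3 -> R) : measurable_fun setT (u : mR3 -> R) ->
  coulomb u = \int[L3]_x ((u x ^+ 2)%:E * potential u x).
Proof.
move=> mu; apply: eq_integral => x _.
have Z := @ge0_integralZl_EFin _ _ _ L3 setT measurableT _
  (fun y _ => potential_integrand_ge0 u x y) (measurable_potential_integrand x mu)
  _ (sqr_ge0 (u x)).
refine (etrans _ Z); apply: eq_integral => y _.
rewrite -EFinM !real_normK ?num_real//.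
exact: (congr1 EFin (esym (GRing.mulrA _ _ _))).
Qed.

Lemma convolution_potential (u : R3 -> R) x :
  convolution (fun z => (enorm z)^-1)%R (fun z => `|u z| ^+ 2)%R x = potential u x.
Proof. by apply: eq_integral => y _; rewrite real_normK ?num_real// mulrC. Qed.

Lemma potential_le (u : R3 -> R) x : H1 u ->
  potential u x <= 8%:E * \int[L3]_y (`|u y| * `|weak_partial ax2 u y|)%:E +
                   8%:E * \int[L3]_y (`|u y| * `|weak_partial ax1 u y|)%:E.
Proof.
move=> Hu; have [mu squ] := H1_sq Hu.
have [mg1 sq1 w1] := weak_partialP ax1 Hu; have [mg2 sq2 w2] := weak_partialP ax2 Hu.
have H2 := @window3_bound R u _ mu mg2 squ sq2 x w2.
have H3 := @window2_bound R u _ mu mg1 squ sq1 x w1.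
apply: le_trans (leeD H2 H3).
have sq0 y : 0 <= (u y ^+ 2)%:E by rewrite lee_fin sqr_ge0.
have msq : measurable_fun setT (fun y : mR3 => (u y ^+ 2)%:E).
  by apply/measurable_EFinP; exact: measurable_funX.
have mw (w : R3 -> R) : measurable_fun setT (w : mR3 -> R) ->
    measurable_fun setT (fun y : mR3 => (u y ^+ 2)%:E * (w y)%:E).
  by move=> m_w; apply: emeasurable_funM => //; exact/measurable_EFinP.
have w0 (w : R3 -> R) y : (0 <= w y)%R -> 0 <= (u y ^+ 2)%:E * (w y)%:E.
  by move=> ?; exact: mule_ge0.
have D := @ge0_integralD _ _ _ L3 setT measurableT _ _
  (fun y _ => w0 _ y (window3_ge0 x y)) (mw _ (measurable_window3 x))
  (fun y _ => w0 _ y (window2_ge0 x y)) (mw _ (measurable_window2 x)).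
refine (eq_ind _ (fun t => _ <= t) _ _ D).
apply: ge0_le_integral_pointwise => y; first exact: potential_integrand_ge0.
rewrite -!EFinM -EFinD lee_fin -mulrDr ler_wpM2l ?sqr_ge0//.
by rewrite enormN; exact: inv_enorm_le_windows.
Qed.

Lemma coulomb_le (u : R3 -> R) (c A e : R) : H1 u -> (0 < c)%R -> (0 < e)%R ->
  \int[L3]_x (u x ^+ 2)%:E = c%:E -> \int[L3]_x (grad_dot u u x)%:E = A%:E ->
  coulomb u <= (e * A + 32 * c ^+ 3 / e)%:E.
Proof.
move=> Hu c0 e0 uc uA; have [mu _] := H1_sq Hu.
have [mg1 _ _] := weak_partialP ax1 Hu; have [mg2 _ _] := weak_partialP ax2 Hu.
pose S i := \int[L3]_x (weak_partial i u x ^+ 2)%:E.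
have S0 i : 0 <= S i by apply: integral_ge0 => x _; rewrite lee_fin sqr_ge0.
have SA : S ord0 + (S ax1 + S ax2) = A%:E by rewrite -uA integral_grad_dot.
(* Young's inequality bounds the potential by [4 d A + 8 c / d]; integrating against [u^2]
   multiplies this by the mass [c], so that this [d] gives [e A + 32 c^3 / e]. *)
pose d := (e / (4 * c))%R; have d0 : (0 < d)%R by rewrite divr_gt0// mulr_gt0.
have M1 := mixed_le d0 mu mg1; have M2 := mixed_le d0 mu mg2.
rewrite uc -/(S _) in M1; rewrite uc -/(S _) in M2.
have {SA S0} [s1 [s2 [E1 E2 s12]]] : exists s1 s2, [/\ S ax1 = s1%:E, S ax2 = s2%:E &
    (s1 + s2 <= A)%R].
  move: (S ord0) (S ax1) (S ax2) (S0 ord0) (S0 ax1) (S0 ax2) SA.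
  move=> [s0||] [s1||] [s2||]// h0 _ _ [E]; exists s1, s2; split=> //.
  by rewrite -E lerDr -lee_fin.
rewrite {}E1 in M1; rewrite {}E2 in M2.
have P x : potential u x <= (4 * d * A + 8 * c / d)%:E.
  apply: (le_trans (potential_le x Hu)).
  apply: (le_trans (leeD (lee_wpmul2l _ M2) (lee_wpmul2l _ M1))); rewrite ?lee_fin//.
  rewrite -subr_ge0 (_ : (_ - _)%R = (4 * (d * (A - (s1 + s2))))%R).
    by apply: mulr_ge0 => //; apply: mulr_ge0; [exact: ltW|rewrite subr_ge0].
  by field; rewrite gt_eqF.
rewrite (coulombE mu).
have sq0 x : 0 <= (u x ^+ 2)%:E by rewrite lee_fin sqr_ge0.
have msq : measurable_fun setT (fun y : mR3 => (u y ^+ 2)%:E).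
  by apply/measurable_EFinP; exact: measurable_funX.
have K0 : (0 <= 4 * d * A + 8 * c / d)%R.
  rewrite -lee_fin; apply: le_trans (P 0%R).
  by apply: integral_ge0 => y _; exact: potential_integrand_ge0.
apply: (@le_trans _ _ ((4 * d * A + 8 * c / d)%:E * \int[L3]_x (u x ^+ 2)%:E)).
  have Z := @ge0_integralZl_EFin _ _ _ L3 setT measurableT _ (fun x _ => sq0 x) msq _ K0.
  rewrite -Z; apply: ge0_le_integral_pointwise => x.
    apply: mule_ge0 => //; apply: integral_ge0 => y _; exact: potential_integrand_ge0.
  by rewrite muleC; apply: lee_wpmul2r.
rewrite uc -EFinM lee_fin le_eqVlt; apply/orP; left; apply/eqP.
by rewrite /d; field; rewrite !gt_eqF.
Qed.

End Coulomb.

(** * The mass-preserving rescaling and the sign of the infimum *)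

Section Scaling.
Context {R : realType}.
Notation R3 := (R * R * R)%type.
Notation mR3 := (measurableTypeR R * measurableTypeR R * measurableTypeR R)%type.
Notation L3 := (@lebesgue3 R).
Local Open Scope ereal_scope.

Lemma integral_scaled (f : mR3 -> R) (s c : R) : (0 < c)%R -> (0 <= s)%R ->
  measurable_fun setT f -> (forall x, 0 <= f x)%R ->
  \int[L3]_x (s * f (dil c x))%:E = (s * c ^- 3)%:E * \int[L3]_x (f x)%:E.
Proof.
move=> c0 s0 mf f0.
have mE : measurable_fun setT (fun x => (f x)%:E) by exact/measurable_EFinP.
have D := ge0_integral_dil c0 mE f0.
have Z := @ge0_integralZl_EFin _ _ _ L3 setT measurableT (fun x => (f (dil c x))%:E)
  (fun x _ => f0 (dil c x)) (measurableT_comp mE (measurable_dil c)) _ s0.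
by rewrite EFinM -muleA -D; exact: Z.
Qed.

(** The dilation [s^(3/2) u (s x)] with [s = t^2]: the squared amplitude [t^6] cancels the Jacobian
    factor [t^-6]. *)
Definition rescale (t : R) (u : R3 -> R) (x : R3) : R := (t ^+ 3 * u (dil (t ^+ 2) x))%R.

Section Rescale.
Variables (t : R) (u : R3 -> R).
Hypotheses (t0 : (0 < t)%R) (Hu : H1 u).

Let t2 : (0 < t ^+ 2)%R. Proof. exact: exprn_gt0. Qed.

Let measurable_scaled (s : R) (f : R3 -> R) : measurable_fun setT (f : mR3 -> R) ->
  measurable_fun setT (fun x : mR3 => (s * f (dil (t ^+ 2) x))%R).
Proof.
move=> mf; apply: measurable_funM => //.
exact: measurableT_comp mf (measurable_dil _).
Qed.

Lemma integral_scaled_sq (s : R) (f : R3 -> R) : measurable_fun setT (f : mR3 -> R) ->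
  \int[L3]_x ((s * f (dil (t ^+ 2) x)) ^+ 2)%:E =
  (s ^+ 2 * (t ^+ 2) ^- 3)%:E * \int[L3]_x (f x ^+ 2)%:E.
Proof.
move=> mf.
have I := @integral_scaled (fun x => f x ^+ 2)%R _ _ t2 (sqr_ge0 s)
  (measurable_funX 2 mf) (fun x => sqr_ge0 (f x)).
by refine (etrans _ I); apply: eq_integral => x _; rewrite exprMn.
Qed.

Lemma rescale_integral_sq : \int[L3]_x (rescale t u x ^+ 2)%:E = \int[L3]_x (u x ^+ 2)%:E.
Proof.
have [mu _] := H1_sq Hu.
refine (etrans (integral_scaled_sq _ mu) _).
by rewrite -!exprM mulfV ?mul1e// gt_eqF// exprn_gt0.
Qed.

Lemma Lfun_scaled (s : R) (f : R3 -> R) : f \in Lfun L3 2%:E ->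
  (fun x : R3 => s * f (dil (t ^+ 2) x))%R \in Lfun L3 2%:E.
Proof.
move=> /Lfun2P[mf sqf]; apply/Lfun2P; split; first exact: measurable_scaled.
rewrite (integral_scaled_sq s mf).
have fin : \int[L3]_x (f x ^+ 2)%:E \is a fin_num.
  by rewrite ge0_fin_numE//; apply: integral_ge0 => x _; rewrite lee_fin sqr_ge0.
by rewrite -(fineK fin) -EFinM ltry.
Qed.

Lemma weak_partial_rescale i g : g \in Lfun L3 2%:E -> weak_partial_of i u g ->
  weak_partial_of i (rescale t u) (fun x => t ^+ 5 * g (dil (t ^+ 2) x))%R.
Proof.
move=> /Lfun2P[mg _] wg; have [mu _] := H1_sq Hu.
have := weak_partial_dil (exprn_gt0 3 t0) t2 mu mg wg.
by rewrite -exprD.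
Qed.

Lemma H1_rescale : H1 (rescale t u).
Proof.
have [uL ug] := Hu; split; first exact: Lfun_scaled.
move=> i; have [g gL wg] := ug i.
exists (fun x => t ^+ 5 * g (dil (t ^+ 2) x))%R; first exact: Lfun_scaled.
exact: weak_partial_rescale.
Qed.

(** [weak_partial] is a chosen representative, so the choice made for the rescaled function must be
    identified, almost everywhere, with the rescaled choice made for [u]; uniqueness of weak
    derivatives does this. *)
Lemma rescale_integral_weak_partial i :
  \int[L3]_x (weak_partial i (rescale t u) x ^+ 2)%:E =
  (t ^+ 4)%:E * \int[L3]_x (weak_partial i u x ^+ 2)%:E.
Proof.
have [mg sqg wg] := weak_partialP i Hu.
have [mh sqh wh] := weak_partialP i H1_rescale.
have gL := proj2 (Lfun2P L3 (weak_partial i u)) (conj mg sqg).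
have hL := proj2 (Lfun2P L3 (weak_partial i (rescale t u))) (conj mh sqh).
have E := weak_partial_unique hL (Lfun_scaled (t ^+ 5) gL) wh (weak_partial_rescale gL wg).
have S := integral_scaled_sq (t ^+ 5) mg.
(* The derivative has amplitude [t^3 t^2 = t^5]; its square meets the Jacobian factor [t^-6]. *)
rewrite (_ : (t ^+ 4)%R = ((t ^+ 5) ^+ 2 * (t ^+ 2) ^- 3)%R); last first.
  by field; rewrite gt_eqF.
refine (etrans _ S).
have sq0 (f : R3 -> R) x : [set: mR3] x -> 0 <= (f x ^+ 2)%:E.
  by rewrite lee_fin sqr_ge0.
have msq (f : R3 -> R) : measurable_fun setT (f : mR3 -> R) ->
    measurable_fun setT (fun x : mR3 => (f x ^+ 2)%:E).
  by move=> mf; apply/measurable_EFinP; exact: measurable_funX.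
refine (@ge0_ae_eq_integral _ _ _ L3 setT _ _ measurableT (msq _ mh)
  (msq _ (measurable_scaled _ mg)) (sq0 _) (sq0 _) _).
by apply: aeS E => x /= Ex _; rewrite Ex.
Qed.

Lemma rescale_integral_grad : \int[L3]_x (grad_dot (rescale t u) (rescale t u) x)%:E =
  (t ^+ 4)%:E * \int[L3]_x (grad_dot u u x)%:E.
Proof.
rewrite (integral_grad_dot Hu).
have E i := rescale_integral_weak_partial i.
refine (etrans (integral_grad_dot H1_rescale)
  (etrans (congr2 _ (E ord0) (congr2 _ (E ax1) (E ax2))) _)).
have S0 i : 0 <= \int[L3]_x (weak_partial i u x ^+ 2)%:E.
  by apply: integral_ge0 => x _; rewrite lee_fin sqr_ge0.
have D (r x y z : \bar R) : 0 <= x -> 0 <= y -> 0 <= z ->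
    r * x + (r * y + r * z) = r * (x + (y + z)).
  by move=> x0 y0 z0; rewrite !ge0_muleDr// adde_ge0.
exact: (D _ _ _ _ (S0 ord0) (S0 ax1) (S0 ax2)).
Qed.

Lemma rescale_integral_powR (p : R) : \int[L3]_x (`|rescale t u x| `^ p)%:E =
  ((t ^+ 3) `^ p * (t ^+ 2) ^- 3)%:E * \int[L3]_x (`|u x| `^ p)%:E.
Proof.
have [mu _] := H1_sq Hu.
have mp : measurable_fun setT (fun x : mR3 => `|u x| `^ p)%R.
  apply: measurableT_comp (measurable_powR p) _.
  exact: measurableT_comp mu.
have I := @integral_scaled (fun x => `|u x| `^ p)%R _ _ t2 (powR_ge0 (t ^+ 3) p)
  mp (fun x => powR_ge0 _ _).
refine (etrans _ I); apply: eq_integral => x _.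
have t3 : (0 <= t ^+ 3)%R by rewrite exprn_ge0// ltW.
by rewrite /rescale normrM powRM// (ger0_norm t3).
Qed.

End Rescale.

Lemma coulomb_ge0 (u : R3 -> R) : 0 <= coulomb u.
Proof.
apply: integral_ge0 => x _; apply: integral_ge0 => y _.
by rewrite lee_fin !mulr_ge0 ?invr_ge0 ?sqrtr_ge0 ?sqr_ge0.
Qed.

Lemma F_rescale_le (p gamma a A B t : R) (u : R3 -> R) : H1 u ->
  (3 <= p)%R -> (0 <= gamma)%R -> (a <= 0)%R -> (0 < t <= 1)%R ->
  \int[L3]_x (grad_dot u u x)%:E = A%:E -> \int[L3]_x (`|u x| `^ p)%:E = B%:E ->
  F p gamma a (rescale t u) <= (t * (A / 2 - a / p * B))%:E.
Proof.
move=> Hu p3 g0 a0 /andP[t0 t1] uA uB.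
have A0 : (0 <= A)%R.
  rewrite -lee_fin -uA; apply: integral_ge0 => x _; rewrite lee_fin.
  by apply: sumr_ge0 => i _; rewrite -expr2 sqr_ge0.
have B0 : (0 <= B)%R.
  by rewrite -lee_fin -uB; apply: integral_ge0 => x _; rewrite lee_fin powR_ge0.
have p0 : (0 < p)%R by apply: lt_le_trans p3.
rewrite /F rescale_integral_grad// rescale_integral_powR// uA uB -/(coulomb _).
have C0 : 0 <= (gamma / 4)%:E * coulomb (rescale t u).
  by apply: mule_ge0; [rewrite lee_fin divr_ge0|exact: coulomb_ge0].
set X := (gamma / 4)%:E * _ in C0 *.
rewrite -!EFinM.
(* For [p >= 3] and [t <= 1], [(t^3)^p <= t^9], which leaves at most [t^3 <= t] after the
   Jacobian. *)
have tp : ((t ^+ 3) `^ p * (t ^+ 2) ^- 3 <= t)%R.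
  rewrite ler_pdivrMr ?exprn_gt0//.
  have h : ((t ^+ 3) `^ p <= (t ^+ 3) `^ 3)%R.
    by apply: ger_powR => //; rewrite exprn_gt0//= exprn_ile1// ltW.
  apply: (le_trans h); rewrite powR_mulrn; last by rewrite exprn_ge0// ltW.
  rewrite -!exprM -exprS.
  rewrite (_ : 3 * 3 = 7 + 2)%N// exprD ler_piMr//; first by rewrite exprn_ge0// ltW.
  by rewrite exprn_ile1// ltW.
have t4 : (t ^+ 4 <= t)%R.
  rewrite exprS ler_piMr//; first by rewrite ltW.
  by rewrite exprn_ile1// ltW.
(* The Coulomb term enters the energy with a nonpositive sign and is dropped here. *)
apply: (@le_trans _ _ ((2^-1 * (t ^+ 4 * A))%:E -
    (a / p * ((t ^+ 3) `^ p * (t ^+ 2) ^- 3 * B))%:E)).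
  by apply: leeD => //; rewrite -[leRHS]adde0; apply: leeD => //; rewrite oppe_le0.
rewrite -EFinB lee_fin.
set s := ((t ^+ 3) `^ p * _)%R in tp *.
have h1 : (t ^+ 4 * A <= t * A)%R by rewrite ler_wpM2r.
have h2 : (s * B <= t * B)%R by rewrite ler_wpM2r.
have h3 : (- (a / p) * (s * B) <= - (a / p) * (t * B))%R.
  by rewrite ler_wpM2l// oppr_ge0 pmulr_lle0// invr_gt0.
have h4 : (2^-1 * (t ^+ 4 * A) <= 2^-1 * (t * A))%R by rewrite ler_pM2l.
rewrite (_ : (t * _)%R = (2^-1 * (t * A) + - (a / p) * (t * B))%R); last first.
  by field; rewrite gt_eqF.
by rewrite -mulNr lerD.
Qed.

Lemma m_le0 (p gamma a c A B : R) (u : R3 -> R) : sphere c u ->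
  (3 <= p)%R -> (0 <= gamma)%R -> (a <= 0)%R ->
  \int[L3]_x (grad_dot u u x)%:E = A%:E -> \int[L3]_x (`|u x| `^ p)%:E = B%:E ->
  m p gamma a c <= 0.
Proof.
move=> [Hu uc] p3 g0 a0 uA uB.
pose K := (A / 2 - a / p * B)%R.
apply/lee_addgt0Pr => e e0; rewrite add0e.
pose t := (Num.min 1 (e / (`|K| + 1)))%R.
have K1 : (0 < `|K| + 1)%R by rewrite ltr_wpDl.
have t0 : (0 < t)%R by rewrite lt_min ltr01 divr_gt0.
have t1 : (t <= 1)%R by rewrite ge_min lexx.
have te : (t * (`|K| + 1) <= e)%R by rewrite -ler_pdivlMr// ge_min lexx orbT.
apply: (@le_trans _ _ (F p gamma a (rescale t u))).
  apply: ereal_inf_lbound; exists (rescale t u) => //; split.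
    exact: H1_rescale.
  by rewrite -uc !integral_Lnorm2 rescale_integral_sq.
apply: le_trans (F_rescale_le Hu p3 g0 a0 _ uA uB) _; first by rewrite t0.
rewrite lee_fin; apply: le_trans te.
rewrite ler_pM2l// -/K; apply: le_trans (ler_norm _) _.
by rewrite lerDl.
Qed.

End Scaling.

(** * The identity obtained by testing the equation against its solution *)

Section Nehari.
Context {R : realType}.
Notation R3 := (R * R * R)%type.
Notation mR3 := (measurableTypeR R * measurableTypeR R * measurableTypeR R)%type.
Notation L3 := (@lebesgue3 R).
Local Open Scope ereal_scope.

Lemma powR_norm_mul (p x : R) : (2 < p)%R -> (`|x| `^ (p - 2) * x * x = `|x| `^ p)%R.
Proof.
move=> p2; have [->|x0] := eqVneq x 0%R.
  by rewrite mulr0 normr0 powR0// gt_eqF// (lt_trans _ p2).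
have E : (`|x| `^ (p - 2 + 2) = `|x| `^ (p - 2) * `|x| `^ 2)%R.
  by rewrite powRD// normr_eq0 x0 implybT.
rewrite subrK in E; rewrite E powR_mulrn// real_normK ?num_real//.
by rewrite -mulrA -expr2.
Qed.

Lemma integral_grad_dot_fin (u : R3 -> R) : H1 u ->
  exists2 A, (0 <= A)%R & \int[L3]_x (grad_dot u u x)%:E = A%:E.
Proof.
move=> Hu.
have S i : exists2 s, (0 <= s)%R & \int[L3]_x (weak_partial i u x ^+ 2)%:E = s%:E.
  have [_ sq _] := weak_partialP i Hu.
  have : 0 <= \int[L3]_x (weak_partial i u x ^+ 2)%:E.
    by apply: integral_ge0 => x _; rewrite lee_fin sqr_ge0.
  by case: (\int[L3]_x _) sq => // s _ s0; exists s.
have [[s0 p0 E0] [[s1 p1 E1] [s2 p2 E2]]] := (S ord0, (S ax1, S ax2)).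
exists (s0 + (s1 + s2))%R; first by rewrite !addr_ge0.
refine (etrans (integral_grad_dot Hu) _).
exact: (congr2 _ E0 (congr2 _ E1 E2)).
Qed.

(* The equation tested against its own solution; since [a < 0], it also forces
   the power integral to be finite. *)
Lemma weak_solution_energy (p gamma a l c : R) (u : R3 -> R) :
  (2 < p)%R -> (a < 0)%R -> (0 < c)%R -> sphere c u -> weak_solution p gamma a l u ->
  exists A D B : R, [/\ \int[L3]_x (grad_dot u u x)%:E = A%:E,
    coulomb u = D%:E, \int[L3]_x (`|u x| `^ p)%:E = B%:E,
    [/\ 0 <= A, 0 <= D & 0 <= B]%R & (A + l * c - gamma * D - a * B = 0)%R].
Proof.
move=> p2 a0 c0 [Hu]; rewrite integral_Lnorm2 => uc [_ /(_ u Hu)].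
have [mu _] := H1_sq Hu.
have [A A0 uA] := integral_grad_dot_fin Hu.
(* Finiteness comes from the Coulomb bound with [e = 1]. With the gradient, mass and Coulomb terms
   finite, an infinite power integral could not be cancelled in the equation. *)
have [D D0 uD] : exists2 D, (0 <= D)%R & coulomb u = D%:E.
  have := coulomb_le Hu c0 ltr01 uc uA; have := coulomb_ge0 u.
  by case: (coulomb u) => // D D0 _; exists D.
have I2 : \int[L3]_x (u x * u x)%:E = c%:E.
  by rewrite -uc; apply: eq_integral => x _; rewrite expr2.
have I3 : \int[L3]_x (convolution (fun z => (enorm z)^-1)%R (fun z => `|u z| ^+ 2)%R x
          * (u x * u x)%:E) = D%:E.
  rewrite -uD coulombE//; apply: eq_integral => x _.
  by rewrite convolution_potential muleC expr2.
have I4 : \int[L3]_x (`|u x| `^ (p - 2) * u x * u x)%:E = \int[L3]_x (`|u x| `^ p)%:E.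
  by apply: eq_integral => x _; rewrite powR_norm_mul.
rewrite uA I2 I3 I4.
have : 0 <= \int[L3]_x (`|u x| `^ p)%:E.
  by apply: integral_ge0 => x _; rewrite lee_fin powR_ge0.
case E : (\int[L3]_x (`|u x| `^ p)%:E) => [B| |]// B0.
  by move=> [Eq]; exists A, D, B; split.
by rewrite lt0_muley ?lte_fin.
Qed.

End Nehari.

Theorem lemma4p5 (R : realType) (p gamma a : R) :
  10 / 3 < p -> p <= 6 -> 0 < gamma -> a < 0 ->
  exists K1 K2 K3 : R,
    [/\ 0 < K1, 0 < K2, 0 < K3 &
     forall c : R, 0 < c ->
     forall (lambda_c : R) (u_c : R * R * R -> R),
       sphere c u_c -> F p gamma a u_c = m p gamma a c ->
       weak_solution p gamma a lambda_c u_c ->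
       (`| m p gamma a c | <= (K1 * c ^+ 3 + K2 * c `^ (2 * p - 3))%:E)%E /\
       lambda_c <= K3 * c ^+ 2].
Proof.
move=> p103 _ g0 a0.
(* [4 gamma^2 = (gamma / 4) * 32 / (2 / gamma)] and [32 gamma^2 = gamma * 32 / gamma^-1]: in the
   energy and in the tested equation respectively, [e] is taken so that the Coulomb bound consumes
   exactly the gradient term. *)
exists (4 * gamma ^+ 2), 1, (32 * gamma ^+ 2); split=> //.
- by rewrite mulr_gt0// exprn_gt0.
- by rewrite mulr_gt0// exprn_gt0.
move=> c c0 l u Su Fu wu; have [Hu] := Su; rewrite integral_Lnorm2 => uc.
have p3 : 3 < p by apply: lt_trans p103; lra.
have p2 : 2 < p by apply: lt_trans p3; lra.
have p0 : 0 < p by apply: lt_trans p2.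
have [A [D [B [uA uD uB [A0 D0 B0] Eq]]]] := weak_solution_energy p2 a0 c0 Su wu.
have Dle e : 0 < e -> D <= e * A + 32 * c ^+ 3 / e.
  by move=> e0; have := coulomb_le Hu c0 e0 uc uA; rewrite uD lee_fin.
have aB : a * B <= 0 by rewrite nmulr_rle0.
have mle := m_le0 Su (ltW p3) (ltW g0) (ltW a0) uA uB.
split; last first.
  have /(ler_wpM2l (ltW g0)) h : D <= gamma^-1 * A + 32 * c ^+ 3 / gamma^-1.
    by apply: Dle; rewrite invr_gt0.
  have h2 : l * c <= 32 * gamma ^+ 2 * c ^+ 2 * c.
    have E : gamma * (gamma^-1 * A + 32 * c ^+ 3 / gamma^-1) =
        A + 32 * gamma ^+ 2 * c ^+ 2 * c.
      by field; rewrite gt_eqF.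
    by rewrite E in h; move: h Eq aB; lra.
  by rewrite ler_pM2r in h2.
have FE : F p gamma a u = (2^-1 * A - gamma / 4 * D - a / p * B)%:E.
  by rewrite /F uA uB -/(coulomb u) uD.
(* The level is attained, so it is a finite number; being nonpositive, it is bounded in absolute
   value by any lower bound of the energy of [u], with the sign changed. *)
rewrite -Fu FE in mle *; rewrite lee_fin in mle.
rewrite -[X in (X <= _)%E]/(EFin _) lee_fin (ler0_norm mle).
have g2 : 0 < 2 / gamma by rewrite divr_gt0.
have h : gamma / 4 * D <= gamma / 4 * (2 / gamma * A + 32 * c ^+ 3 / (2 / gamma)).
  by rewrite ler_wpM2l ?Dle// ltW// divr_gt0.
have E : gamma / 4 * (2 / gamma * A + 32 * c ^+ 3 / (2 / gamma)) =
    2^-1 * A + 4 * gamma ^+ 2 * c ^+ 3.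
  by field; rewrite gt_eqF.
have pB : a / p * B <= 0 by rewrite mulrAC pmulr_lle0// invr_gt0.
have q0 := powR_ge0 c (2 * p - 3).
by rewrite E in h; move: h pB q0; lra.
Qed.
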